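(* Let $d\ge 2$, $\rho\in[0,1)$ and $Q\in O(d)$, and let $(U,V)$ be a random vector on $S^{d-1}\times S^{d-1}$ with density $$c(u,v)=\frac{1}{A_{d-1}^2}\,\frac{1-\rho^2}{(1-2\rho\,u'Qv+\rho^2)^{d/2}},\qquad u,v\in S^{d-1}.$$ Then $E(U)=E(V)=0$, $E(UU')=E(VV')=d^{-1}I$ and $E(UV')=d^{-1}\rho Q$. Consequently the Johnson–Wehrly correlation coefficient satisfies $\rho_{JW}=\lambda^{1/2}=\rho$, where $\lambda$ is the largest eigenvalue of $\Sigma_{UU}^{-1}\Sigma_{UV}\Sigma_{VV}^{-1}\Sigma_{UV}'$ with $\Sigma_{UU}=E(UU')-E(U)E(U')$, $\Sigma_{UV}=E(UV')-E(U)E(V')$, $\Sigma_{VV}=E(VV')-E(V)E(V')$.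
   Context: $S^{d-1}=\{x\in\mathbb{R}^d:\|x\|=1\}$, $x'$ denotes transpose, $O(d)$ is the group of $d\times d$ orthogonal matrices, $I$ is the $d\times d$ identity matrix, and $A_{d-1}=2\pi^{d/2}/\Gamma(d/2)$ is the surface area of $S^{d-1}$. *)

(* Defs.v *)
From HB Require Import structures.
From mathcomp Require Import all_boot all_order all_algebra.
From mathcomp Require Import all_classical all_reals all_analysis.
Set Implicit Arguments. Unset Strict Implicit. Unset Printing Implicit Defensive.
Import Order.TTheory GRing.Theory Num.Theory.
Import numFieldNormedType.Exports.
Local Open Scope classical_set_scope.
Local Open Scope ring_scope.

Section Defs.
Context {R : realType}.

(* Lebesgue integral over R^n, written as the iterated one-dimensional
   Lebesgue integral (equal to the integral w.r.t. the n-dimensional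
   Lebesgue measure by Fubini for integrable / nonnegative f). *)
Fixpoint lebesgue_int_Rn (n : nat) : (n.-tuple R -> \bar R) -> \bar R :=
  match n return (n.-tuple R -> \bar R) -> \bar R with
  | 0 => fun f => f [tuple]
  | n'.+1 => fun f =>
      (\int[@lebesgue_measure R]_(x in [set: R])
         lebesgue_int_Rn (fun t : n'.-tuple R => f [tuple of x :: t]))%E
  end.

Definition rv_of_tuple (n : nat) (t : n.-tuple R) : 'rV[R]_n :=
  \row_(i < n) tnth t i.

Definition enorm (n : nat) (x : 'rV[R]_n) : R :=
  Num.sqrt (\sum_(i < n) x 0 i ^+ 2).

Definition sphere (n : nat) : set 'rV[R]_n := [set x | enorm x = 1].

(* Integral over S^{n-1} with respect to the (unnormalized) surface measure,
   defined through the cone-measure / polar-coordinate identity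
   int_{S^{n-1}} g dsigma = n * int_{0 < |x| <= 1} g(x/|x|) dx. *)
Definition sphere_int (n : nat) (g : 'rV[R]_n -> \bar R) : \bar R :=
  ((n%:R)%:E * lebesgue_int_Rn (fun t : n.-tuple R =>
     let x := rv_of_tuple t in
     if ((0 < enorm x) && (enorm x <= 1))%R then g ((enorm x)^-1 *: x)%R
     else 0%E))%E.

Definition Gamma (s : R) : R :=
  fine (\int[@lebesgue_measure R]_(t in `[0%R, +oo[)
          ((t `^ (s - 1)) * expR (- t))%:E)%E.

Definition sphere_area (d : nat) : R :=
  2 * pi `^ (d%:R / 2) / Gamma (d%:R / 2).

Definition jw_density (d : nat) (rho : R) (Q : 'M[R]_d)
    (u v : 'rV[R]_d) : R :=
  (sphere_area d ^+ 2)^-1 * (1 - rho ^+ 2) /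
    ((1 - 2 * rho * (u *m Q *m v^T) 0 0 + rho ^+ 2) `^ (d%:R / 2)).

Definition expect_dens (d : nat) (c : 'rV[R]_d -> 'rV[R]_d -> R)
    (h : 'rV[R]_d -> 'rV[R]_d -> R) : \bar R :=
  sphere_int (fun u => sphere_int (fun v => (h u v * c u v)%:E)).

Definition mean_U d c : 'rV[R]_d := \row_i fine (expect_dens c (fun u _ => u 0 i)).
Definition mean_V d c : 'rV[R]_d := \row_i fine (expect_dens c (fun _ v => v 0 i)).
Definition mom_UU d c : 'M[R]_d :=
  \matrix_(i, j) fine (expect_dens c (fun u _ => u 0 i * u 0 j)).
Definition mom_VV d c : 'M[R]_d :=
  \matrix_(i, j) fine (expect_dens c (fun _ v => v 0 i * v 0 j)).
Definition mom_UV d c : 'M[R]_d :=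
  \matrix_(i, j) fine (expect_dens c (fun u v => u 0 i * v 0 j)).

(* covariance matrices; E(U) is stored as a row vector, so E(U)E(V)' = mU^T mV *)
Definition Sigma_UU d (c : 'rV[R]_d -> 'rV[R]_d -> R) : 'M[R]_d :=
  mom_UU c - (mean_U c)^T *m mean_U c.
Definition Sigma_VV d (c : 'rV[R]_d -> 'rV[R]_d -> R) : 'M[R]_d :=
  mom_VV c - (mean_V c)^T *m mean_V c.
Definition Sigma_UV d (c : 'rV[R]_d -> 'rV[R]_d -> R) : 'M[R]_d :=
  mom_UV c - (mean_U c)^T *m mean_V c.

Definition jw_matrix d (c : 'rV[R]_d -> 'rV[R]_d -> R) : 'M[R]_d :=
  invmx (Sigma_UU c) *m Sigma_UV c *m invmx (Sigma_VV c) *m (Sigma_UV c)^T.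

Definition largest_eigenvalue d (M : 'M[R]_d) (l : R) : Prop :=
  eigenvalue M l /\ forall m, eigenvalue M m -> m <= l.

End Defs.

(* Main.v *)
(** For fixed [u] write [w = uQ], [t = w.v] and [D = 1 - 2 rho t + rho^2]; the
    density is [A^-2 (1 - rho^2) D^(-d/2)].  Lebesgue measure is invariant under
    O(d), hence so is the cone surface measure; this gives the moments of the
    uniform law, makes [int D^(-d/2)] independent of [w], and makes
    [int v D^(-d/2)] a multiple of [w].  Differentiating along a one-parameter
    family of reflections yields
      [int (1 - t^2) f'(t) = (d - 1) int t f(t)].
    Applied to [f = D^(-d/2)] it shows that [M = int (1 - rho t) D^(-d/2)] has
    zero derivative in [rho]; and [N = int D^(1 - d/2)] satisfies
    [rho N' = (d - 2) (M - N)], so that [rho^(d-2) (N - A)] is constant.  Hence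
    [M = N = A], and [(1 - rho^2) int D^(-d/2) = 2 M - N = A],
    [(1 - rho^2) int t D^(-d/2) = rho A].  The value [A = 2 pi^(d/2) / Gamma(d/2)]
    comes from the Gaussian integral by the layer cake formula. *)
Require Import Defs.
From HB Require Import structures.
From mathcomp Require Import all_boot all_order all_algebra.
From mathcomp Require Import all_classical all_reals all_analysis.
From mathcomp Require Import measurable_realfun ring lra.
Import Order.TTheory GRing.Theory Num.Theory.
Import numFieldNormedType.Exports.
Local Open Scope classical_set_scope.
Local Open Scope ring_scope.
Set Implicit Arguments. Unset Strict Implicit. Unset Printing Implicit Defensive.

(** * Lebesgue measure on tuples *)

Section tuple_lebesgue.
Context {R : realType}.
Local Notation leb := (@lebesgue_measure R).

(** [sphere_int] unfolds to an iterated one-dimensional integral, which is not by itself an integral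
    against a measure on tuples. The measure [tuple_lebesgue] is therefore built by the same
    recursion. The two integrals are shown to agree on measurable functions bounded by a multiple of
    the indicator of a cube; this is where the boundedness asked by [sphere_fun] comes from.

    Invariance under O(d) is obtained without any Jacobian: the argument is the uniqueness of Haar
    measure, with the Gaussian as test function. Apart from the given [Q] and its transpose, the
    symmetries used later are single Householder reflections (or the identity): sign change of a
    coordinate, transport of one unit vector to another, and a curve of reflections in a coordinate
    plane.

    The value of a quantity that is constant in [rho] is read off at [rho = 0], where the integrands
    of M and N are both 1. Finiteness of the Gamma integral is not assumed: it follows from the
    layer cake identity, whose other side is finite and positive. *)

Definition tuple_cons n (p : measurableTypeR R * n.-tuple R) : n.+1.-tuple R :=
  [tuple of p.1 :: p.2].

Lemma measurable_tuple_cons n :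
  measurable_fun [set: measurableTypeR R * n.-tuple R] (@tuple_cons n).
Proof. by apply: measurable_cons. Qed.

Definition tuple_uncons n (t : n.+1.-tuple R) : measurableTypeR R * n.-tuple R :=
  (thead t, [tuple of behead t]).

Lemma tuple_consK n : cancel (@tuple_cons n) (@tuple_uncons n).
Proof.
case=> x t; rewrite /tuple_uncons /tuple_cons; congr pair => //; exact: val_inj.
Qed.

Lemma measurable_tuple_uncons n : measurable_fun [set: n.+1.-tuple R] (@tuple_uncons n).
Proof.
apply: measurable_fun_pair; first exact: (@measurable_tnth _ _ _ ord0).
exact: measurable_behead.
Qed.

Section step.
Variables (n : nat) (m : {sigma_finite_measure set (n.-tuple R) -> \bar R}).

Definition tuple_lebesgueS : set (n.+1.-tuple R) -> \bar R :=
  pushforward (leb \x m)%E (@tuple_cons n).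

HB.instance Definition _ := Measure.copy tuple_lebesgueS
  (measure_function_pushforward__canonical__measure_function_Measure
    (leb \x m)%E (@measurable_tuple_cons n)).

(** Sigma-finiteness must travel along the recursion, since the next product measure and its Tonelli
    theorem rest on it. Exhaustions of the two factors are paired index by index, which still covers
    because both are nondecreasing. *)
Lemma tuple_lebesgueS_sigma_finite : sigma_finite setT tuple_lebesgueS.
Proof.
have /sigma_finiteP[F [TF ndF Foo]] := sigma_finiteT leb.
have /sigma_finiteP[G [TG ndG Goo]] := sigma_finiteT m.
exists (fun i => @tuple_uncons n @^-1` (F i `*` G i)).
  rewrite -preimage_bigcup; apply/seteqP; split => // t _ /=.
  case: (tuple_uncons t) => x y.
  have [i _ Fi] : (\bigcup_i F i) x by rewrite -TF.
  have [k _ Gk] : (\bigcup_i G i) y by rewrite -TG.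
  exists (maxn i k) => //; split.
    by move: x Fi; exact/subsetPset/ndF/leq_maxl.
  by move: y Gk; exact/subsetPset/ndG/leq_maxr.
move=> i; have [? ?] := Foo i; have [? ?] := Goo i; split.
  rewrite -[X in measurable X]setTI; apply: measurable_tuple_uncons => //.
  exact: measurableX.
rewrite /tuple_lebesgueS /pushforward.
rewrite (_ : _ @^-1` _ = F i `*` G i).
  by rewrite product_measure1E// lte_mul_pinfty// ge0_fin_numE.
by apply/seteqP; split => x; rewrite /preimage /mkset tuple_consK.
Qed.

HB.instance Definition _ := Measure_isSigmaFinite.Build _ _ _ tuple_lebesgueS
  tuple_lebesgueS_sigma_finite.

Lemma ge0_integral_tuple_lebesgueS (f : n.+1.-tuple R -> \bar R) :
  measurable_fun setT f -> (forall t, 0 <= f t)%E ->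
  (\int[tuple_lebesgueS]_t f t =
   \int[leb]_x \int[m]_t f [tuple of x :: t])%E.
Proof.
move=> mf f0.
have := @ge0_integral_pushforward _ _ _ _ _ _ (@measurable_tuple_cons n)
  (leb \x m)%E setT f measurableT mf (fun t _ => f0 t).
move=> ->.
rewrite preimage_setT fubini_tonelli1//; last by move=> x; exact: f0.
by apply: measurableT_comp => //; exact: measurable_tuple_cons.
Qed.

Lemma integral_tuple_lebesgueS (f : n.+1.-tuple R -> \bar R) :
  measurable_fun setT f -> tuple_lebesgueS.-integrable setT f ->
  (\int[tuple_lebesgueS]_t f t =
   \int[leb]_x \int[m]_t f [tuple of x :: t])%E.
Proof.
move=> mf intf.
have mfc : measurable_fun setT (f \o @tuple_cons n).
  by apply: measurableT_comp => //; exact: measurable_tuple_cons.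
have intfc : (leb \x m)%E.-integrable setT (f \o @tuple_cons n).
  apply/integrable12ltyP => //.
  have /integrableP[_] := intf.
  by rewrite ge0_integral_tuple_lebesgueS//; exact: measurableT_comp.
have := @integral_pushforward _ _ _ _ _ _ (@measurable_tuple_cons n)
  (leb \x m)%E setT f mf intfc measurableT.
by move=> ->; rewrite preimage_setT -integral12_prod_meas1.
Qed.

End step.

(** Follows the recursion of [lebesgue_int_Rn] so that the two can be compared by induction on [n].
    In dimension 0 the point mass gives the single value of the function. *)
Fixpoint tuple_lebesgue n : {sigma_finite_measure set (n.-tuple R) -> \bar R} :=
  match n return {sigma_finite_measure set (n.-tuple R) -> \bar R} with
  | 0 => @dirac _ (0.-tuple R) [tuple] R
  | n'.+1 => tuple_lebesgueS (tuple_lebesgue n')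
  end.

End tuple_lebesgue.

(** * Translations and dilations of the real line *)

Section affine_substitution.
Context {R : realType}.
Local Notation leb := (@lebesgue_measure R).
Local Open Scope ereal_scope.

Lemma lebesgue_measure_shift (a : R) (A : set R) : measurable A ->
  leb ((fun x : R => (x + a)%R) @^-1` A) = leb A.
Proof.
move=> mA.
have ms : measurable_fun [set: measurableTypeR R]
    ((fun x => (x + a)%R) : _ -> measurableTypeR R).
  exact: measurable_funD.
rewrite -[LHS]/(pushforward leb ((fun x => (x + a)%R) : _ -> measurableTypeR R) A).
apply/esym/lebesgue_measure_unique => //= _ [[u v]] _ <-.
rewrite /pushforward.
rewrite (_ : _ @^-1` _ = `](u - a)%R, (v - a)%R]%classic); last first.
  by apply/seteqP; split => x /=; rewrite !in_itv/= ltrBlDr lerBrDr.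
by rewrite !lebesgue_measure_itv/= !lte_fin ltrD2r -!EFinD opprD opprK addrA addrAC subrK.
Qed.

Lemma ge0_integral_shift (a : R) (f : R -> \bar R) :
  measurable_fun setT f -> (forall x, 0 <= f x) ->
  \int[leb]_x f (x + a)%R = \int[leb]_x f x.
Proof.
move=> mf f0.
have ms : measurable_fun [set: measurableTypeR R]
    ((fun x => (x + a)%R) : _ -> measurableTypeR R).
  exact: measurable_funD.
rewrite -[LHS]/(\int[leb]_(x in
  ((fun x => (x + a)%R) : _ -> measurableTypeR R) @^-1` setT)
  (f \o (fun x => (x + a)%R)) x).
rewrite -ge0_integral_pushforward//.
by apply: eq_measure_integral => A mA _; exact: lebesgue_measure_shift.
Qed.

Lemma lebesgue_measure_scale (c : R) (c0 : (0 < c)%R) (A : set R) : measurable A ->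
  leb A = c%:E * leb ((fun x : R => (c * x)%R) @^-1` A).
Proof.
move=> mA.
have ms : measurable_fun [set: measurableTypeR R]
    ((fun x => (c * x)%R) : _ -> measurableTypeR R).
  exact: measurable_funM.
pose m : {measure set (measurableTypeR R) -> \bar R} := mscale (NngNum (ltW c0))
  (measure_function_pushforward__canonical__measure_function_Measure leb ms).
rewrite -[RHS]/(m A).
apply: lebesgue_measure_unique => //= _ [[u v]] _ <-.
rewrite /m /mscale/= /pushforward.
rewrite (_ : _ @^-1` _ = `](u / c)%R, (v / c)%R]%classic); last first.
  by apply/seteqP; split => x /=; rewrite !in_itv/= ltr_pdivrMr// ler_pdivlMr// mulrC.
rewrite !lebesgue_measure_itv/= !lte_fin ltr_pM2r ?invr_gt0//.
case: ifPn => _; last by rewrite mule0.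
by rewrite -!EFinD -EFinM -mulrBl mulrC divfK ?gt_eqF.
Qed.

Lemma ge0_integral_scale (c : R) (c0 : (0 < c)%R) (f : R -> \bar R) :
  measurable_fun setT f -> (forall x, 0 <= f x) ->
  \int[leb]_x f x = c%:E * \int[leb]_x f (c * x)%R.
Proof.
move=> mf f0.
have ms : measurable_fun [set: measurableTypeR R]
    ((fun x => (c * x)%R) : _ -> measurableTypeR R).
  exact: measurable_funM.
rewrite -[X in _ * X]/(\int[leb]_(x in
  ((fun x => (c * x)%R) : _ -> measurableTypeR R) @^-1` setT)
  (f \o (fun x => (c * x)%R)) x).
rewrite -ge0_integral_pushforward//.
pose m : {measure set (measurableTypeR R) -> \bar R} :=
  (measure_function_pushforward__canonical__measure_function_Measure leb ms).
have := @ge0_integral_mscale _ _ _ m setT measurableT (NngNum (ltW c0)) f mf (fun x _ => f0 x).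
move=> /= <-.
by apply: eq_measure_integral => A mA _; exact: lebesgue_measure_scale.
Qed.

End affine_substitution.

(** * Translation, scaling and product integrands in dimension n *)

Section tuple_lebesgue_theory.
Context {R : realType}.
Local Notation leb := (@lebesgue_measure R).
Local Notation mu := (@tuple_lebesgue R).

Definition tuple_add n (t a : n.-tuple R) : n.-tuple R :=
  [tuple tnth t i + tnth a i | i < n].

Definition tuple_scale n (c : R) (t : n.-tuple R) : n.-tuple R :=
  [tuple c * tnth t i | i < n].

Lemma measurable_fun_tuple d (T : measurableType d) n (f : 'I_n -> T -> R) :
  (forall i, measurable_fun setT (f i)) ->
  measurable_fun setT (fun x => [tuple f i x | i < n]).
Proof.
move=> mf; apply/measurable_fun_tnthP => i.
by apply: eq_measurable_fun (mf i) => x _ /=; rewrite tnth_mktuple.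
Qed.

Lemma measurable_tuple_add n (a : n.-tuple R) :
  measurable_fun setT (fun t => tuple_add t a).
Proof.
apply: measurable_fun_tuple => i; apply: measurable_funD => //.
exact: measurable_tnth.
Qed.

Lemma measurable_tuple_scale n (c : R) :
  measurable_fun setT (@tuple_scale n c).
Proof.
apply: measurable_fun_tuple => i; apply: measurable_funM => //.
exact: measurable_tnth.
Qed.

Lemma tuple_add_cons n (x a : R) (t b : n.-tuple R) :
  tuple_add [tuple of x :: t] [tuple of a :: b] =
  [tuple of x + a :: tuple_add t b].
Proof.
apply: eq_from_tnth => i; rewrite tnth_mktuple.
by case: (unliftP ord0 i) => [j|] ->; rewrite ?tnth0 ?tnthS ?tnth_mktuple.
Qed.

Lemma tuple_scale_cons n (c x : R) (t : n.-tuple R) :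
  tuple_scale c [tuple of x :: t] = [tuple of c * x :: tuple_scale c t].
Proof.
apply: eq_from_tnth => i; rewrite tnth_mktuple.
by case: (unliftP ord0 i) => [j|] ->; rewrite ?tnth0 ?tnthS ?tnth_mktuple.
Qed.

Local Open Scope ereal_scope.

Lemma measurable_integral_cons n (f : n.+1.-tuple R -> \bar R) :
  measurable_fun setT f -> (forall t, 0 <= f t) ->
  measurable_fun [set: measurableTypeR R]
    (fun x : measurableTypeR R => \int[mu n]_t f [tuple of x :: t]).
Proof.
move=> mf f0.
apply: (@measurable_fun_fubini_tonelli_F _ _ (measurableTypeR R) _ _ _
  (fun p => f (@tuple_cons R n p))) => //.
by apply: measurableT_comp => //; exact: measurable_tuple_cons.
Qed.

Lemma ge0_integral_tuple_add n (a : n.-tuple R) (f : n.-tuple R -> \bar R) :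
  measurable_fun setT f -> (forall t, 0 <= f t) ->
  \int[mu n]_t f (tuple_add t a) = \int[mu n]_t f t.
Proof.
elim: n a f => [|n IHn] a f mf f0.
  by apply: eq_integral => t _; rewrite (tuple0 (tuple_add _ _)) (tuple0 t).
rewrite [RHS]ge0_integral_tuple_lebesgueS// [LHS]ge0_integral_tuple_lebesgueS//; last first.
  by apply: measurableT_comp => //; exact: measurable_tuple_add.
rewrite (tuple_eta a).
transitivity (\int[leb]_x \int[mu n]_t f [tuple of (x + thead a)%R :: t]).
  apply: eq_integral => x _.
  under eq_integral do rewrite tuple_add_cons.
  apply: (IHn _ (fun t => f [tuple of (x + thead a)%R :: t])) => //.
  by apply: measurableT_comp => //; exact: measurable_cons.
apply: (@ge0_integral_shift _ _ (fun x => \int[mu n]_t f [tuple of x :: t])).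
  exact: measurable_integral_cons.
by move=> x; exact: integral_ge0.
Qed.

Lemma ge0_integral_tuple_scale n (c : R) (c0 : (0 < c)%R) (f : n.-tuple R -> \bar R) :
  measurable_fun setT f -> (forall t, 0 <= f t) ->
  \int[mu n]_t f t = (c ^+ n)%:E * \int[mu n]_t f (tuple_scale c t).
Proof.
elim: n f => [|n IHn] f mf f0.
  rewrite expr0 mul1e.
  by apply: eq_integral => t _; rewrite (tuple0 (tuple_scale _ _)) (tuple0 t).
rewrite [LHS]ge0_integral_tuple_lebesgueS// [in RHS]ge0_integral_tuple_lebesgueS//; last first.
  by apply: measurableT_comp => //; exact: measurable_tuple_scale.
rewrite (ge0_integral_scale c0); last 2 first.
- exact: measurable_integral_cons.
- by move=> x; exact: integral_ge0.
rewrite exprS EFinM -muleA; congr (_ * _).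
rewrite -ge0_integralZl//; first last.
- by rewrite lee_fin exprn_ge0// ltW.
- by move=> x _; exact: integral_ge0.
- have := @measurable_integral_cons n (fun t => f (tuple_scale c t)).
  by apply => //; apply: measurableT_comp => //; exact: measurable_tuple_scale.
apply: eq_integral => x _.
under [in RHS]eq_integral do rewrite tuple_scale_cons.
apply: (IHn (fun t => f [tuple of (c * x)%R :: t])) => //.
by apply: measurableT_comp => //; exact: measurable_cons.
Qed.

Lemma measurable_fun_prod_tnth n (g : R -> R) : measurable_fun setT g ->
  measurable_fun setT (fun t : n.-tuple R => \prod_(i < n) g (tnth t i))%R.
Proof.
move=> mg; apply: measurable_prod => i _.
by apply: measurableT_comp => //; exact: measurable_tnth.
Qed.

(** Serves three times: for the Gaussian, for the indicator of the cube ([c = 2]), and for the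
    indicator of the origin ([c = 0]). *)
Lemma integral_prod_tnth n (g : R -> R) (c : R) :
  measurable_fun setT g -> (forall x, 0 <= g x)%R ->
  \int[leb]_x (g x)%:E = c%:E ->
  \int[mu n]_t (\prod_(i < n) g (tnth t i))%:E = (c ^+ n)%:E.
Proof.
move=> mg g0 gc; elim: n => [|n IHn].
  under eq_integral do rewrite big_ord0.
  by rewrite [LHS]integral_dirac// diracT mul1e expr0.
have mp k : measurable_fun setT (fun t : k.-tuple R => (\prod_(i < k) g (tnth t i))%:E).
  by apply/measurable_EFinP; exact: measurable_fun_prod_tnth.
have p0 k (t : k.-tuple R) : 0 <= (\prod_(i < k) g (tnth t i))%:E.
  by rewrite lee_fin; apply: prodr_ge0.
rewrite [LHS]ge0_integral_tuple_lebesgueS//.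
transitivity (\int[leb]_x ((g x)%:E * (c ^+ n)%:E)).
  apply: eq_integral => x _.
  under eq_integral.
    move=> t _; rewrite big_ord_recl tnth0 EFinM.
    under eq_bigr do rewrite tnthS.
    over.
  rewrite /= ge0_integralZl ?IHn//; [exact: mp|by move=> t _; exact: p0|by rewrite lee_fin].
rewrite ge0_integralZr//; first by rewrite gc exprS EFinM.
- exact/measurable_EFinP.
- by move=> x _; rewrite lee_fin.
- by rewrite lee_fin exprn_ge0// -lee_fin -gc; apply: integral_ge0 => x _; rewrite lee_fin.
Qed.

End tuple_lebesgue_theory.

(** * Invariance under orthogonal maps *)

Section isometry.
Context {R : realType}.
Local Notation leb := (@lebesgue_measure R).
Local Notation mu := (@tuple_lebesgue R).
Local Open Scope ereal_scope.

Lemma measurable_fun_tuple_add d (T : measurableType d) n (f g : T -> n.-tuple R) :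
  measurable_fun setT f -> measurable_fun setT g ->
  measurable_fun setT (fun x => tuple_add (f x) (g x)).
Proof.
move=> /measurable_fun_tnthP mf /measurable_fun_tnthP mg.
by apply: measurable_fun_tuple => i; apply: measurable_funD; [exact: mf|exact: mg].
Qed.

Lemma measurable_fun_tuple_scale d (T : measurableType d) n (c : T -> R) (f : T -> n.-tuple R) :
  measurable_fun setT c -> measurable_fun setT f ->
  measurable_fun setT (fun x => tuple_scale (c x) (f x)).
Proof.
move=> mc /measurable_fun_tnthP mf.
by apply: measurable_fun_tuple => i; apply: measurable_funM => //; exact: mf.
Qed.

(* Uniqueness of Haar measure, specialized to an additive bijection: evaluate
   the double integral of [f (L y) * g (x - L y)] in both orders. *)
Lemma ge0_integral_additive n (L K : n.-tuple R -> n.-tuple R)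
    (g : n.-tuple R -> \bar R) (c : R) :
  measurable_fun setT L ->
  (forall t a, L (tuple_add t a) = tuple_add (L t) (L a)) ->
  cancel K L ->
  measurable_fun setT g -> (forall t, 0 <= g t) ->
  (forall t, g (tuple_scale (-1) (L t)) = g t) ->
  (0 < c)%R -> \int[mu n]_t g t = c%:E ->
  forall f, measurable_fun setT f -> (forall t, 0 <= f t) ->
  \int[mu n]_t f (L t) = \int[mu n]_t f t.
Proof.
move=> mL LD LK mg g0 gL c0 gc f mf f0.
have mfL : measurable_fun setT (f \o L) by exact: measurableT_comp.
(* The factor [c] is finite and positive, so it cancels even if the integrals of [f] are
   infinite. *)
suff : \int[mu n]_t f (L t) * c%:E = \int[mu n]_t f t * c%:E.
  move=> /(congr1 (fun x => x * (c^-1)%:E)).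
  by rewrite -!muleA -!EFinM divff ?gt_eqF// !mule1.
rewrite -[in LHS]gc.
have mNL : measurable_fun setT (fun t => tuple_scale (-1) (L t)).
  exact: measurable_fun_tuple_scale.
rewrite -ge0_integralZr//; last exact: integral_ge0.
transitivity (\int[mu n]_y \int[mu n]_x (f (L y) * g (tuple_add x (tuple_scale (-1) (L y))))).
  apply: eq_integral => y _; rewrite ge0_integralZl//.
    by rewrite ge0_integral_tuple_add.
  by apply: measurableT_comp => //; exact: measurable_tuple_add.
rewrite (@fubini_tonelli _ _ _ _ _ (mu n) (mu n)
  (fun p => f (L p.1) * g (tuple_add p.2 (tuple_scale (-1) (L p.1)))))//; first last.
- by move=> p; exact: mule_ge0.
- apply: emeasurable_funM; first exact: (measurableT_comp mfL).
  apply: (measurableT_comp mg); apply: measurable_fun_tuple_add => //.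
  exact: (measurableT_comp mNL).
transitivity (\int[mu n]_x \int[mu n]_y (f (tuple_add x (L y)) * g y)).
  apply: eq_integral => x _ /=.
  (* Replacing [y] by [y + K x] turns [L y] into [L y + x]; the argument of [g] becomes [- L y], and
     [gL] removes [L]. *)
  rewrite -(@ge0_integral_tuple_add _ _ (K x)); first last.
  - by move=> t; exact: mule_ge0.
  - apply: emeasurable_funM => //.
    by apply: (measurableT_comp mg); apply: measurable_fun_tuple_add.
  apply: eq_integral => y _; rewrite LD LK; congr (f _ * _).
    by apply: eq_from_tnth => i; rewrite !tnth_mktuple addrC.
  rewrite -[RHS]gL; congr g.
  by apply: eq_from_tnth => i; rewrite !tnth_mktuple !mulN1r opprD addrCA subrr addr0.
rewrite (@fubini_tonelli _ _ _ _ _ (mu n) (mu n)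
  (fun p => f (tuple_add p.1 (L p.2)) * g p.2))//; first last.
- by move=> p; exact: mule_ge0.
- apply: emeasurable_funM; last exact: (measurableT_comp mg).
  apply: (measurableT_comp mf); apply: measurable_fun_tuple_add => //.
  exact: (measurableT_comp mL).
rewrite -gc -ge0_integralZl//; last exact: integral_ge0.
apply: eq_integral => y _ /=.
rewrite ge0_integralZr//; last by apply: (measurableT_comp mf); exact: measurable_tuple_add.
by rewrite ge0_integral_tuple_add.
Qed.

Definition tuple_gauss n (t : n.-tuple R) : R := (\prod_(i < n) gauss_fun (tnth t i))%R.

Lemma tuple_gaussE n (t : n.-tuple R) :
  tuple_gauss t = expR (- \sum_(i < n) tnth t i ^+ 2)%R.
Proof. by rewrite /tuple_gauss -expR_sum sumrN. Qed.

Lemma integral_tuple_gauss n :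
  \int[mu n]_t (tuple_gauss t)%:E = (Num.sqrt pi ^+ n)%:E.
Proof.
apply: integral_prod_tnth; [exact: measurable_gauss_fun|exact: gauss_fun_ge0|].
exact: integralT_gauss.
Qed.

Definition tuple_mulmx n (Q : 'M[R]_n) (t : n.-tuple R) : n.-tuple R :=
  [tuple (rv_of_tuple t *m Q)%R ord0 i | i < n].

Lemma rv_of_tuple_mulmx n (Q : 'M[R]_n) t :
  rv_of_tuple (tuple_mulmx Q t) = (rv_of_tuple t *m Q)%R.
Proof. by apply/rowP => i; rewrite mxE tnth_mktuple. Qed.

Lemma rv_of_tuple_inj n : injective (@rv_of_tuple R n).
Proof.
by move=> t u /rowP tu; apply: eq_from_tnth => i; have := tu i; rewrite !mxE.
Qed.

Lemma rv_of_tuple_add n (t u : n.-tuple R) :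
  rv_of_tuple (tuple_add t u) = (rv_of_tuple t + rv_of_tuple u)%R.
Proof. by apply/rowP => i; rewrite !mxE tnth_mktuple. Qed.

Lemma rv_of_tuple_scale n c (t : n.-tuple R) :
  rv_of_tuple (tuple_scale c t) = (c *: rv_of_tuple t)%R.
Proof. by apply/rowP => i; rewrite !mxE tnth_mktuple. Qed.

Lemma sqr_sum_mulmx n (x : 'rV[R]_n) :
  (\sum_(i < n) x ord0 i ^+ 2 = (x *m x^T) ord0 ord0)%R.
Proof. by rewrite mxE; apply: eq_bigr => i _; rewrite mxE. Qed.

Lemma measurable_fun_lincomb n (t0 : 'I_n -> R) :
  measurable_fun setT (fun t : n.-tuple R => (\sum_(i < n) tnth t i * t0 i)%R).
Proof.
apply: measurable_sum => i; apply: measurable_funM => //; exact: measurable_tnth.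
Qed.

Lemma measurable_tuple_mulmx n (Q : 'M[R]_n) :
  measurable_fun setT (tuple_mulmx Q).
Proof.
apply: measurable_fun_tuple => i.
under eq_fun => t do rewrite mxE; under eq_fun => t do under eq_bigr do rewrite mxE.
exact: measurable_fun_lincomb.
Qed.

(** The Gaussian is a valid test function: it depends on the norm only, so it is even and invariant
    under [Q], and its integral is known, finite and positive. *)
Lemma ge0_integral_orthogonal n (Q : 'M[R]_n) : (Q *m Q^T = 1%:M)%R ->
  forall f, measurable_fun setT f -> (forall t, 0 <= f t) ->
  \int[mu n]_t f (tuple_mulmx Q t) = \int[mu n]_t f t.
Proof.
move=> QQ.
apply: (@ge0_integral_additive _ _ (tuple_mulmx Q^T)%R
  (EFin \o @tuple_gauss n) (Num.sqrt pi ^+ n)%R).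
- exact: measurable_tuple_mulmx.
- move=> t a; apply: rv_of_tuple_inj.
  by rewrite rv_of_tuple_add !rv_of_tuple_mulmx rv_of_tuple_add mulmxDl.
- move=> t; apply: rv_of_tuple_inj.
  by rewrite !rv_of_tuple_mulmx -mulmxA (mulmx1C QQ) mulmx1.
- apply/measurable_EFinP; apply: measurable_fun_prod_tnth; exact: measurable_gauss_fun.
- by move=> t; rewrite lee_fin; apply: prodr_ge0 => i _; exact: gauss_fun_ge0.
- move=> t /=; rewrite !tuple_gaussE; congr (expR (- _))%:E.
  transitivity (\sum_(i < n) (rv_of_tuple t *m Q) ord0 i ^+ 2)%R.
    by apply: eq_bigr => i _; rewrite !tnth_mktuple mulN1r sqrrN.
  rewrite sqr_sum_mulmx trmx_mul mulmxA -(mulmxA (rv_of_tuple t)) QQ mulmx1.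
  by rewrite -sqr_sum_mulmx; apply: eq_bigr => i _; rewrite mxE.
- by rewrite exprn_gt0// sqrtr_gt0 pi_gt0.
- exact: integral_tuple_gauss.
Qed.

Lemma integral_orthogonal n (Q : 'M[R]_n) : (Q *m Q^T = 1%:M)%R ->
  forall f, measurable_fun setT f ->
  \int[mu n]_t f (tuple_mulmx Q t) = \int[mu n]_t f t.
Proof.
move=> QQ f mf; rewrite integralE [RHS]integralE; congr (_ - _).
  have := ge0_integral_orthogonal QQ (measurable_funepos mf).
  move=> <-; last exact: funepos_ge0.
  by apply: eq_integral => t _; rewrite (funepos_comp f (tuple_mulmx Q)).
have := ge0_integral_orthogonal QQ (measurable_funeneg mf).
move=> <-; last exact: funeneg_ge0.
by apply: eq_integral => t _; rewrite (funeneg_comp f (tuple_mulmx Q)).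
Qed.

(** A cube containing the unit ball. The product form matters: fixing the first coordinate leaves a
    multiple of the same indicator in one dimension less. *)
Definition cube_indic n (t : n.-tuple R) : R :=
  (\prod_(i < n) \1_(`[(-1)%R, 1%R]%classic : set R) (tnth t i))%R.

Lemma integrable_cube_bounded n (f : n.-tuple R -> R) C :
  measurable_fun setT f -> (forall t, `|f t| <= C * cube_indic t)%R ->
  (mu n).-integrable setT (EFin \o f).
Proof.
move=> mf fC.
have m1 : measurable_fun setT (\1_(`[(-1)%R, 1%R]%classic : set R) : R -> R).
  exact: measurable_indic.
have mc : measurable_fun setT (@cube_indic n) by exact: measurable_fun_prod_tnth.
have ic : (mu n).-integrable setT (EFin \o @cube_indic n).
  apply/integrableP; split; first exact/measurable_EFinP.
  under eq_integral => t _.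
    rewrite /= ger0_norm; last by apply: prodr_ge0 => i _; rewrite indicE.
    over.
  rewrite (@integral_prod_tnth _ _ _ 2%R)//; first by rewrite ltry.
  rewrite integral_indic// setIT.
  apply: (etrans (lebesgue_measure_itv `[(-1)%R, 1%R])) => /=.
  by rewrite lte_fin gtrN// -EFinD opprK.
apply: (@le_integrable _ _ _ _ _ measurableT _ (fun t => C%:E * (EFin \o @cube_indic n) t)).
- exact/measurable_EFinP.
- move=> t _ /=; rewrite lee_fin normrM (ger0_norm (_ : 0 <= cube_indic t)%R).
    by rewrite (le_trans (fC t))// ler_wpM2r ?ler_norm//; apply: prodr_ge0 => i _; rewrite indicE.
  by apply: prodr_ge0 => i _; rewrite indicE.
- exact: integrableZl.
Qed.

(** The induction needs every section of [f] to satisfy the hypothesis again, not merely almost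
    every one. Domination by [cube_indic] is inherited, with the constant [C] multiplied by the
    indicator of [[-1, 1]] at the fixed coordinate. *)
Lemma lebesgue_int_Rn_cube_bounded n (f : n.-tuple R -> R) C :
  measurable_fun setT f -> (forall t, `|f t| <= C * cube_indic t)%R ->
  lebesgue_int_Rn (EFin \o f) = \int[mu n]_t (f t)%:E.
Proof.
elim: n f C => [|n IHn] f C mf fC.
  by rewrite [RHS]integral_dirac// ?diracT ?mul1e//; exact/measurable_EFinP.
rewrite [RHS]integral_tuple_lebesgueS//; first last.
- exact: integrable_cube_bounded fC.
- exact/measurable_EFinP.
rewrite /=; apply: eq_integral => x _.
apply: (IHn (fun t => f [tuple of x :: t]) (C * \1_(`[(-1)%R, 1%R]%classic : set R) x)%R).
  by apply: measurableT_comp => //; exact: measurable_cons.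
move=> t; apply: (le_trans (fC _)).
rewrite /cube_indic big_ord_recl tnth0 mulrA.
by under eq_bigr do rewrite tnthS.
Qed.

End isometry.

(** * Integration over the sphere *)

Section euclidean.
Context {R : realType}.
Implicit Types n : nat.

Definition dot n (u v : 'rV[R]_n) : R := (u *m v^T) ord0 ord0.

Lemma dotE n (u v : 'rV[R]_n) : dot u v = \sum_(i < n) u ord0 i * v ord0 i.
Proof. by rewrite /dot mxE; apply: eq_bigr => i _; rewrite mxE. Qed.

Lemma dotC n (u v : 'rV[R]_n) : dot u v = dot v u.
Proof. by rewrite !dotE; apply: eq_bigr => i _; rewrite mulrC. Qed.

Lemma sqr_enorm n (x : 'rV[R]_n) : enorm x ^+ 2 = dot x x.
Proof.
rewrite sqr_sqrtr; first by rewrite dotE; apply: eq_bigr => i _; rewrite expr2.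
by apply: sumr_ge0 => i _; exact: sqr_ge0.
Qed.

Lemma enorm_ge0 n (x : 'rV[R]_n) : 0 <= enorm x.
Proof. exact: sqrtr_ge0. Qed.

Lemma enormE n (x : 'rV[R]_n) : enorm x = Num.sqrt (dot x x).
Proof. by rewrite -sqr_enorm sqrtr_sqr ger0_norm ?enorm_ge0. Qed.

Lemma enorm1P n (x : 'rV[R]_n) : (enorm x = 1) <-> (dot x x = 1).
Proof.
rewrite -sqr_enorm; split => [->|/eqP]; first by rewrite expr1n.
rewrite sqrf_eq1 => /orP[/eqP//|/eqP xN1].
by have := enorm_ge0 x; rewrite xN1 oppr_ge0 ler10.
Qed.

Lemma enormZ n c (x : 'rV[R]_n) : enorm (c *: x) = `|c| * enorm x.
Proof.
rewrite !enormE -sqrtr_sqr -sqrtrM ?sqr_ge0//; congr Num.sqrt.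
by rewrite !dotE mulr_sumr; apply: eq_bigr => i _; rewrite !mxE; ring.
Qed.

Lemma le_coord_enorm n (x : 'rV[R]_n) i : `|x ord0 i| <= enorm x.
Proof.
rewrite -sqrtr_sqr ler_wsqrtr// (bigD1 i)//= lerDl.
by apply: sumr_ge0 => j _; exact: sqr_ge0.
Qed.

Lemma dot_mulmx n (Q : 'M[R]_n) (u v : 'rV[R]_n) : Q *m Q^T = 1%:M ->
  dot (u *m Q) (v *m Q) = dot u v.
Proof. by move=> QQ; rewrite /dot trmx_mul mulmxA -(mulmxA u) QQ mulmx1. Qed.

Lemma enorm_mulmx n (Q : 'M[R]_n) (u : 'rV[R]_n) : Q *m Q^T = 1%:M ->
  enorm (u *m Q) = enorm u.
Proof. by move=> QQ; rewrite !enormE dot_mulmx. Qed.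

Lemma dot_sphere_le1 n (u v : 'rV[R]_n) : enorm u = 1 -> enorm v = 1 ->
  `|dot u v| <= 1.
Proof.
move=> /enorm1P u1 /enorm1P v1.
(* The squared norm of [u - s v] is nonnegative; [s = 1] and [s = -1] give the two bounds. *)
have key (s : R) : s ^+ 2 = 1 -> 0 <= 2 - 2 * s * dot u v.
  move=> s1; suff -> : 2 - 2 * s * dot u v = \sum_i (u ord0 i - s * v ord0 i) ^+ 2.
    by apply: sumr_ge0 => i _; exact: sqr_ge0.
  transitivity (\sum_i (u ord0 i * u ord0 i + v ord0 i * v ord0 i * s ^+ 2
      - 2 * s * (u ord0 i * v ord0 i))).
    rewrite sumrB big_split/= -mulr_sumr -mulr_suml -!dotE u1 v1 s1; ring.
  by apply: eq_bigr => i _; ring.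
have := key 1 (expr1n _ _); have := key (-1) (etrans (sqrrN 1) (expr1n _ _)).
rewrite ler_norml => k1 k2; apply/andP; split; lra.
Qed.

End euclidean.

(** * The surface integral as a real-valued functional *)

Section sphere_functional.
Context {R : realType}.
Local Notation mu := (@tuple_lebesgue R).
Implicit Types n : nat.

Definition pball n : set (n.-tuple R) :=
  [set t | (0 < enorm (rv_of_tuple t)) && (enorm (rv_of_tuple t) <= 1)].

Definition direction n (t : n.-tuple R) : 'rV[R]_n :=
  (enorm (rv_of_tuple t))^-1 *: rv_of_tuple t.

Lemma direction_sphere n (t : n.-tuple R) : pball t -> enorm (direction t) = 1.
Proof.
move=> /andP[t0 _]; rewrite enormZ ger0_norm ?invr_ge0 ?(ltW t0)//.
by rewrite mulVf// gt_eqF.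
Qed.

Lemma measurable_enorm n :
  measurable_fun setT (fun t : n.-tuple R => enorm (rv_of_tuple t)).
Proof.
apply: (@measurableT_comp _ _ _ _ _ _ (@Num.sqrt R)).
  by apply: continuous_measurable_fun; exact: sqrt_continuous.
apply: measurable_sum => i.
under eq_fun do rewrite mxE.
by apply: measurable_funX; exact: measurable_tnth.
Qed.

Lemma measurable_pball n : measurable (@pball n).
Proof.
have mn := @measurable_enorm n.
have mb : measurable_fun setT (fun t : n.-tuple R =>
    (0 < enorm (rv_of_tuple t)) && (enorm (rv_of_tuple t) <= 1)).
  by apply: measurable_and; [exact: measurable_fun_ltr|exact: measurable_fun_ler].
by have := mb measurableT [set true] I; rewrite setTI.
Qed.

Lemma measurable_direction n (g : 'rV[R]_n -> R) :
  measurable_fun setT (g \o @rv_of_tuple R n) -> measurable_fun setT (g \o @direction n).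
Proof.
move=> mg.
have -> : g \o @direction n = (g \o @rv_of_tuple R n) \o
    (fun t => tuple_scale (enorm (rv_of_tuple t) `^ (-1)) t).
  apply/funext => t /=; congr g; rewrite rv_of_tuple_scale powR_inv1//.
  exact: enorm_ge0.
apply: measurableT_comp => //; apply: measurable_fun_tuple_scale => //.
apply: (@measurableT_comp _ _ _ _ _ _ (@powR R ^~ (-1))); first exact: measurable_powR.
exact: measurable_enorm.
Qed.

(* Measurability is only asked of the pullback to the punctured ball, so that the
   class is stable under [u |-> \int F(u, v) dv], see [sphere_fun_Rint]. *)
Definition sphere_fun n (g : 'rV[R]_n -> R) :=
  measurable_fun (@pball n) (g \o @direction n) /\
  exists C, forall v, enorm v = 1 -> `|g v| <= C.

Lemma sphere_funP n (g : 'rV[R]_n -> R) C :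
  measurable_fun setT (g \o @rv_of_tuple R n) ->
  (forall v, enorm v = 1 -> `|g v| <= C) -> sphere_fun g.
Proof.
move=> mg gC; split; last by exists C.
exact: (measurable_funTS (measurable_direction mg)).
Qed.

Lemma cube_indic_pball n (t : n.-tuple R) : (pball t : Prop) -> cube_indic t = 1.
Proof.
move=> /andP[_ t1]; rewrite /cube_indic big1// => i _.
rewrite indicE mem_set//= in_itv/= -ler_norml (le_trans _ t1)//.
by have := le_coord_enorm (rv_of_tuple t) i; rewrite mxE.
Qed.

Lemma sphere_fun_cube n (g : 'rV[R]_n -> R) : sphere_fun g ->
  exists C, forall t, `|((g \o @direction n) \_ (@pball n)) t| <= C * cube_indic t.
Proof.
move=> [_ [C gC]]; exists `|C| => t; rewrite patchE; case: ifPn.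
  rewrite inE => tp; rewrite cube_indic_pball// mulr1 (le_trans _ (ler_norm _))//.
  by apply: gC; exact: direction_sphere.
move=> _; rewrite normr0 mulr_ge0//.
by apply: prodr_ge0 => i _; rewrite indicE.
Qed.

Lemma measurable_patch_direction n (g : 'rV[R]_n -> R) : sphere_fun g ->
  measurable_fun setT ((g \o @direction n) \_ (@pball n)).
Proof.
move=> [mg _]; have /(_ mg) := iffLR
  (measurable_restrictT (g \o @direction n) (@measurable_pball n)).
by [].
Qed.

Lemma integrable_sphere_fun n (g : 'rV[R]_n -> R) : sphere_fun g ->
  (mu n).-integrable (@pball n) (EFin \o (g \o @direction n)).
Proof.
move=> sg; have [C gC] := sphere_fun_cube sg.
apply: (iffRL (integrable_mkcond _ (@measurable_pball n))).
by rewrite restrict_EFin; exact: integrable_cube_bounded (measurable_patch_direction sg) gC.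
Qed.

(** Real-valued form of [sphere_int], related to it by [sphere_intE]; linearity and differentiation
    in a parameter are stated for this form. *)
Definition sphere_Rint n (g : 'rV[R]_n -> R) : R :=
  n%:R * \int[mu n]_(t in @pball n) g (direction t).

Lemma sphere_intE n (g : 'rV[R]_n -> R) : sphere_fun g ->
  sphere_int (fun v => (g v)%:E) = (sphere_Rint g)%:E.
Proof.
move=> sg; have [C gC] := sphere_fun_cube sg.
rewrite /sphere_int /sphere_Rint EFinM; congr (_ * _)%E.
rewrite /Rintegral fineK; last first.
  apply: integrable_fin_num; first exact: measurable_pball.
  exact: (integrable_sphere_fun sg).
rewrite [RHS]integral_mkcond.
rewrite -[LHS]/(lebesgue_int_Rn _) (_ : (fun t => _) = EFin \o ((g \o @direction n) \_ (@pball n))).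
  rewrite (lebesgue_int_Rn_cube_bounded (measurable_patch_direction sg) gC).
  by apply: eq_integral => t _; rewrite /= !patchE; case: ifPn.
apply/funext => t /=; rewrite patchE; case: ifPn => tp.
  by rewrite mem_set.
by rewrite memNset//; exact/negP.
Qed.

Lemma eq_sphere_int n (f g : 'rV[R]_n -> \bar R) :
  (forall v, enorm v = 1 -> f v = g v) -> sphere_int f = sphere_int g.
Proof.
move=> fg; rewrite /sphere_int; congr (_ * lebesgue_int_Rn _)%E.
apply/funext => t; case: ifPn => // tp; apply: fg.
exact: direction_sphere.
Qed.

Lemma eq_sphere_Rint n (f g : 'rV[R]_n -> R) :
  (forall v, enorm v = 1 -> f v = g v) -> sphere_Rint f = sphere_Rint g.
Proof.
move=> fg; congr (_ * _); apply: eq_Rintegral => t; rewrite inE => tp.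
by apply: fg; exact: direction_sphere.
Qed.

Lemma sphere_RintD n (f g : 'rV[R]_n -> R) : sphere_fun f -> sphere_fun g ->
  sphere_Rint (fun v => f v + g v) = sphere_Rint f + sphere_Rint g.
Proof.
move=> sf sg; rewrite /sphere_Rint -mulrDr RintegralD//.
- exact: measurable_pball.
- exact: integrable_sphere_fun sf.
- exact: integrable_sphere_fun sg.
Qed.

Lemma sphere_RintZ n c (f : 'rV[R]_n -> R) : sphere_fun f ->
  sphere_Rint (fun v => c * f v) = c * sphere_Rint f.
Proof.
move=> sf; rewrite /sphere_Rint RintegralZl//; first by rewrite mulrCA.
- exact: measurable_pball.
- exact: integrable_sphere_fun sf.
Qed.

(** An orthogonal map preserves the punctured ball and commutes with [direction], so the invariance
    of Lebesgue measure passes to the cone measure. *)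
Lemma sphere_Rint_mulmx n (Q : 'M[R]_n) (g : 'rV[R]_n -> R) :
  Q *m Q^T = 1%:M -> sphere_fun g ->
  sphere_Rint (fun v => g (v *m Q)) = sphere_Rint g.
Proof.
move=> QQ sg; rewrite /sphere_Rint /Rintegral.
have mh : measurable_fun setT (EFin \o ((g \o @direction n) \_ (@pball n))).
  by apply/measurable_EFinP; exact: measurable_patch_direction.
have E := integral_orthogonal QQ mh.
rewrite [in RHS]integral_mkcond [in LHS]integral_mkcond.
have -> : ((fun t => (g (direction t))%:E) \_ (@pball n) =
    EFin \o ((g \o @direction n) \_ (@pball n)))%E by rewrite -restrict_EFin.
rewrite -E; congr (_ * fine _); apply: eq_integral => t _.
rewrite /comp !patchE /=.
have -> : (tuple_mulmx Q t \in @pball n) = (t \in @pball n).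
  by apply/idP/idP; rewrite !inE /pball/= rv_of_tuple_mulmx enorm_mulmx.
case: ifPn => // _.
by rewrite /direction rv_of_tuple_mulmx enorm_mulmx// scalemxAl.
Qed.

End sphere_functional.

(** * Closure properties of the integrable class, in one and two variables *)

Section sphere_fun_closure.
Context {R : realType}.
Local Notation mu := (@tuple_lebesgue R).
Implicit Types n : nat.

Lemma sphere_fun_cst n (c : R) : sphere_fun (fun _ : 'rV[R]_n => c).
Proof. by apply: (@sphere_funP _ _ _ `|c|) => //; exact: measurable_cst. Qed.

Lemma sphere_fun_coord n (i : 'I_n) : sphere_fun (fun v : 'rV[R]_n => v ord0 i).
Proof.
apply: (@sphere_funP _ _ _ 1) => [|v v1]; last by rewrite -v1 le_coord_enorm.
apply: eq_measurable_fun (@measurable_tnth _ _ _ i) => t _.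
by rewrite /= mxE.
Qed.

Lemma sphere_funM n (f g : 'rV[R]_n -> R) : sphere_fun f -> sphere_fun g ->
  sphere_fun (fun v => f v * g v).
Proof.
move=> [mf [C fC]] [mg [D gD]]; split; first by have := measurable_funM mf mg.
exists (C * D) => v v1; rewrite normrM; apply: ler_pM => //.
  exact: fC.
exact: gD.
Qed.

Lemma sphere_funD n (f g : 'rV[R]_n -> R) : sphere_fun f -> sphere_fun g ->
  sphere_fun (fun v => f v + g v).
Proof.
move=> [mf [C fC]] [mg [D gD]]; split; first by have := measurable_funD mf mg.
exists (C + D) => v v1; rewrite (le_trans (ler_normD _ _))// lerD//.
  exact: fC.
exact: gD.
Qed.

Lemma sphere_funZ n c (f : 'rV[R]_n -> R) : sphere_fun f -> sphere_fun (fun v => c * f v).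
Proof. by move=> sf; apply: sphere_funM => //; exact: sphere_fun_cst. Qed.

Lemma sphere_funB n (f g : 'rV[R]_n -> R) : sphere_fun f -> sphere_fun g ->
  sphere_fun (fun v => f v - g v).
Proof.
move=> sf /(sphere_funZ (-1)) sg; have := sphere_funD sf sg.
by under eq_fun do rewrite mulN1r.
Qed.

Lemma sphere_fun_sum n (I : finType) (f : I -> 'rV[R]_n -> R) :
  (forall i, sphere_fun (f i)) -> sphere_fun (fun v => \sum_i f i v).
Proof.
move=> sf; have : forall r : seq I, sphere_fun (fun v => \sum_(i <- r) f i v).
  elim=> [|i r IH].
    by under eq_fun do rewrite big_nil; exact: sphere_fun_cst.
  by under eq_fun do rewrite big_cons; exact: sphere_funD.
exact.
Qed.

Lemma sphere_fun_comp n (f : R -> R) (g : 'rV[R]_n -> R) C :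
  measurable_fun setT f -> sphere_fun g ->
  (forall v, enorm v = 1 -> `|f (g v)| <= C) -> sphere_fun (fun v => f (g v)).
Proof.
move=> mf [mg _] fC; split; last by exists C.
by apply: (@measurable_comp _ _ _ _ _ _ setT f) => //; exact: measurable_pball.
Qed.

Lemma eq_sphere_fun n (f g : 'rV[R]_n -> R) :
  (forall v, enorm v = 1 -> f v = g v) -> sphere_fun f -> sphere_fun g.
Proof.
move=> fg [mf [C fC]]; split; last by exists C => v v1; rewrite -fg// fC.
apply: eq_measurable_fun mf => t; rewrite inE => tp /=.
by apply: fg; exact: direction_sphere.
Qed.

Lemma sphere_fun_mulmx n (Q : 'M[R]_n) (g : 'rV[R]_n -> R) :
  Q *m Q^T = 1%:M -> sphere_fun g -> sphere_fun (fun v => g (v *m Q)).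
Proof.
move=> QQ [mg [C gC]]; split; last first.
  by exists C => v v1; apply: gC; rewrite enorm_mulmx.
rewrite (_ : _ \o _ = (g \o @direction R n) \o @tuple_mulmx R n Q); last first.
  apply/funext => t /=.
  by rewrite /direction rv_of_tuple_mulmx enorm_mulmx// scalemxAl.
apply: (@measurable_comp _ _ _ _ _ _ (@pball R n)) => //.
- exact: measurable_pball.
- move=> _ [t + <-]; rewrite /pball/= rv_of_tuple_mulmx enorm_mulmx//.
- exact: (measurable_funTS (measurable_tuple_mulmx Q)).
Qed.

Lemma sphere_fun_dot n (w : 'rV[R]_n) : sphere_fun (fun v => dot w v).
Proof.
under eq_fun do rewrite dotE.
by apply: sphere_fun_sum => i; apply: sphere_funZ; exact: sphere_fun_coord.
Qed.

Lemma sphere_RintB n (f g : 'rV[R]_n -> R) : sphere_fun f -> sphere_fun g ->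
  sphere_Rint (fun v => f v - g v) = sphere_Rint f - sphere_Rint g.
Proof.
move=> sf sg; rewrite -[in RHS]mulN1r -sphere_RintZ// -sphere_RintD//.
  by apply: eq_sphere_Rint => v _; rewrite mulN1r.
exact: sphere_funZ.
Qed.

Lemma sphere_Rint_sum n (I : finType) (f : I -> 'rV[R]_n -> R) :
  (forall i, sphere_fun (f i)) ->
  sphere_Rint (fun v => \sum_i f i v) = \sum_i sphere_Rint (f i).
Proof.
move=> sf.
have : forall r : seq I, sphere_fun (fun v => \sum_(i <- r) f i v) /\
    sphere_Rint (fun v => \sum_(i <- r) f i v) = \sum_(i <- r) sphere_Rint (f i).
  elim=> [|i r [IH1 IH2]].
    under eq_fun do rewrite big_nil; split; first exact: sphere_fun_cst.
    rewrite big_nil -[RHS](mul0r (sphere_Rint (fun _ : 'rV[R]_n => 0))).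
    rewrite -sphere_RintZ; last exact: sphere_fun_cst.
    by apply: eq_sphere_Rint => v _; rewrite mul0r.
  under eq_fun do rewrite big_cons; split; first exact: sphere_funD.
  by rewrite sphere_RintD// IH2 big_cons.
by move=> /(_ (index_enum I))[].
Qed.

Lemma normr_sphere_Rint n (f : 'rV[R]_n -> R) C :
  sphere_fun f -> (forall v, enorm v = 1 -> `|f v| <= C) ->
  `|sphere_Rint f| <= sphere_Rint (fun _ : 'rV[R]_n => C).
Proof.
move=> sf fC; rewrite /sphere_Rint normrM ger0_norm//; apply: ler_wpM2l => //.
have mp := @measurable_pball R n.
apply: (le_trans (le_normr_Rintegral mp (integrable_sphere_fun sf))).
apply: le_Rintegral => //.
- have := integrable_norm (integrable_sphere_fun sf).
  by [].
- exact: (integrable_sphere_fun (sphere_fun_cst n C)).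
- by move=> t tp; apply: fC; exact: direction_sphere.
Qed.

Definition sphere_fun2 n (F : 'rV[R]_n -> 'rV[R]_n -> R) :=
  measurable_fun (@pball R n `*` @pball R n)
    (fun p : n.-tuple R * n.-tuple R => F (direction p.1) (direction p.2)) /\
  exists C, forall u v, enorm u = 1 -> enorm v = 1 -> `|F u v| <= C.

Lemma sphere_fun2P n (F : 'rV[R]_n -> 'rV[R]_n -> R) C :
  measurable_fun setT
    (fun p : n.-tuple R * n.-tuple R => F (direction p.1) (direction p.2)) ->
  (forall u v, enorm u = 1 -> enorm v = 1 -> `|F u v| <= C) -> sphere_fun2 F.
Proof. by move=> mF FC; split; [exact: measurable_funTS|exists C]. Qed.

Lemma sphere_fun2_swap n (F : 'rV[R]_n -> 'rV[R]_n -> R) :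
  sphere_fun2 F -> sphere_fun2 (fun u v => F v u).
Proof.
move=> [mF [C FC]]; split; last by exists C => u v u1 v1; exact: FC.
apply: (@measurable_comp _ _ _ _ _ _ (@pball R n `*` @pball R n)
  (fun p : n.-tuple R * n.-tuple R => F (direction p.1) (direction p.2)) _
  (fun p => (p.2, p.1))) => //.
- by apply: measurableX; exact: measurable_pball.
- by move=> _ [[x y] [/= ? ?] <-].
- by apply: measurable_funTS; apply: measurable_fun_pair.
Qed.

Lemma sphere_fun2_section n (F : 'rV[R]_n -> 'rV[R]_n -> R) u :
  sphere_fun2 F -> enorm u = 1 -> sphere_fun (F u).
Proof.
move=> [mF [C FC]] u1; split; last by exists C => v v1; exact: FC.
(* A unit vector lies in the punctured ball and is its own direction, so the section at [u] is a
   section of the pullback at a point of its domain. *)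
pose t0 : n.-tuple R := [tuple u ord0 i | i < n].
have rt0 : rv_of_tuple t0 = u by apply/rowP => i; rewrite mxE tnth_mktuple.
have dt0 : direction t0 = u by rewrite /direction rt0 u1 invr1 scale1r.
have pt0 : pball t0 by rewrite /pball/= rt0 u1 ltr01 lexx.
rewrite (_ : _ \o _ = (fun p : n.-tuple R * n.-tuple R =>
    F (direction p.1) (direction p.2)) \o (pair t0)); last first.
  by apply/funext => t /=; rewrite dt0.
apply: (@measurable_comp _ _ _ _ _ _ (@pball R n `*` @pball R n)) => //.
- by apply: measurableX; exact: measurable_pball.
- by move=> _ [t tp <-]; split.
- by apply: measurable_funTS; exact: measurable_fun_pair.
Qed.

End sphere_fun_closure.

(** * Exchange of two surface integrals *)

Section sphere_fubini.
Context {R : realType}.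
Local Notation mu := (@tuple_lebesgue R).
Implicit Types n : nat.

(** Extension by zero to the whole space, where Fubini applies. The factor [n] is that of the inner
    [sphere_Rint]; the outer one stays outside the integral. *)
Let kernel2 n (F : 'rV[R]_n -> 'rV[R]_n -> R) : n.-tuple R * n.-tuple R -> R :=
  (fun p => n%:R * F (direction p.1) (direction p.2)) \_ (@pball R n `*` @pball R n).

Let integrable_kernel2 n (F : 'rV[R]_n -> 'rV[R]_n -> R) : sphere_fun2 F ->
  (mu n \x mu n)%E.-integrable setT (EFin \o kernel2 F).
Proof.
move=> [mF [C FC]].
have mp : measurable (@pball R n `*` @pball R n).
  by apply: measurableX; exact: measurable_pball.
have mc : measurable_fun setT (@cube_indic R n).
  by apply: measurable_fun_prod_tnth; exact: measurable_indic.
have c0 t : 0 <= @cube_indic R n t.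
  by apply: prodr_ge0 => i _; rewrite indicE.
have mcc : measurable_fun setT (fun p : n.-tuple R * n.-tuple R =>
    (cube_indic p.1 * cube_indic p.2)%:E).
  apply/measurable_EFinP; apply: measurable_funM.
    exact: (measurableT_comp mc measurable_fst).
  exact: (measurableT_comp mc measurable_snd).
have ic : (mu n).-integrable setT (EFin \o @cube_indic R n).
  by apply: (@integrable_cube_bounded _ _ _ 1) => // t; rewrite mul1r ger0_norm.
have icc : (mu n \x mu n)%E.-integrable setT
    (fun p : n.-tuple R * n.-tuple R => (cube_indic p.1 * cube_indic p.2)%:E).
  apply/integrable12ltyP => //.
  have cE x y : (`|(@cube_indic R n x * @cube_indic R n y)%:E| =
      (cube_indic x)%:E * (cube_indic y)%:E)%E.
    by rewrite /= ger0_norm ?mulr_ge0// EFinM.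
  rewrite (eq_integral (fun x => (cube_indic x)%:E * \int[mu n]_y (cube_indic y)%:E)%E); last first.
    move=> x _; rewrite -ge0_integralZl//; last 3 first.
    - exact/measurable_EFinP.
    - by move=> y _; rewrite lee_fin.
    - by rewrite lee_fin.
    by apply: eq_integral => y _; exact: cE.
  have fc := integrable_fin_num measurableT ic.
  rewrite ge0_integralZr//; first last.
  - by apply: integral_ge0 => y _; rewrite lee_fin.
  - by move=> x _; rewrite lee_fin.
  - exact/measurable_EFinP.
  by rewrite ltey_eq fin_numM.
apply: (@le_integrable _ _ _ _ _ measurableT _
  (fun p : n.-tuple R * n.-tuple R => (n%:R * C)%:E * (cube_indic p.1 * cube_indic p.2)%:E)%E).
- apply/measurable_EFinP; apply: (iffLR (measurable_restrictT _ mp)).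
  exact: measurable_funM.
- move=> [x y] _; rewrite /kernel2 /= lee_fin patchE; case: ifPn => [|_]; last first.
    by rewrite normr0.
  rewrite inE => -[/= px py]; rewrite !cube_indic_pball// !mulr1 !normrM.
  apply: ler_wpM2l => //; apply: (le_trans _ (ler_norm _)).
  by apply: FC; exact: direction_sphere.
- by have := integrableZl measurableT (n%:R * C) icc.
Qed.

Let integral_kernel2 n (F : 'rV[R]_n -> 'rV[R]_n -> R) (x : n.-tuple R) :
  sphere_fun2 F ->
  (\int[mu n]_y (kernel2 F (x, y))%:E =
  (((fun t => sphere_Rint (F (direction t))) \_ (@pball R n)) x)%:E)%E.
Proof.
move=> sF; rewrite patchE; case: ifPn => [|xp].
  rewrite inE => px.
  have sf : sphere_fun (F (direction x)).
    by apply: sphere_fun2_section => //; exact: direction_sphere.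
  rewrite -[RHS]/((sphere_Rint _)%:E) /sphere_Rint -RintegralZl; last 2 first.
  - exact: measurable_pball.
  - exact: (integrable_sphere_fun sf).
  rewrite /Rintegral fineK; last first.
    apply: integrable_fin_num; first exact: measurable_pball.
    exact: (integrable_sphere_fun (sphere_funZ n%:R sf)).
  rewrite [RHS]integral_mkcond; apply: eq_integral => y _.
  rewrite /kernel2 !patchE in_setX (mem_set px) /=.
  by case: ifPn.
rewrite integral0_eq// => y _; rewrite /kernel2 patchE in_setX.
by rewrite (negbTE xp).
Qed.

Lemma sphere_fun_Rint n (F : 'rV[R]_n -> 'rV[R]_n -> R) : sphere_fun2 F ->
  sphere_fun (fun u => sphere_Rint (F u)).
Proof.
move=> sF; split; last first.
  have [_ [C FC]] := sF; exists (sphere_Rint (fun _ : 'rV[R]_n => C)) => u u1.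
  apply: normr_sphere_Rint; first exact: sphere_fun2_section.
  by move=> v v1; exact: FC.
have := measurable_fubini_F (integrable_kernel2 sF).
rewrite /fubini_F => m.
apply: (iffRL (measurable_restrictT _ (@measurable_pball R n))).
apply/measurable_EFinP; apply: eq_measurable_fun m => x _.
exact: integral_kernel2.
Qed.

Lemma sphere_Rint_swap n (F : 'rV[R]_n -> 'rV[R]_n -> R) : sphere_fun2 F ->
  sphere_Rint (fun u => sphere_Rint (F u)) =
  sphere_Rint (fun v => sphere_Rint (fun u => F u v)).
Proof.
move=> sF; have sF' := sphere_fun2_swap sF.
have key G : sphere_fun2 G -> sphere_Rint (fun u => sphere_Rint (G u)) =
    n%:R * fine (\int[mu n]_x \int[mu n]_y (kernel2 G (x, y))%:E)%E.
  move=> sG; rewrite {1}/sphere_Rint; congr (_ * fine _).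
  rewrite [LHS]integral_mkcond; apply: eq_integral => x _.
  by rewrite integral_kernel2// !patchE; case: ifPn.
rewrite [LHS](key _ sF).
transitivity (n%:R *
    fine (\int[mu n]_x \int[mu n]_y (kernel2 (fun v u => F u v) (x, y))%:E)%E);
  last first.
  exact/esym/(key _ sF').
apply: (congr1 (fun z => n%:R * fine z)).
apply: (etrans (Fubini (integrable_kernel2 sF))).
apply: eq_integral => x _; apply: eq_integral => y _.
by rewrite /kernel2 /= !patchE !in_setX/= andbC.
Qed.

End sphere_fubini.

(** * Differentiation under the surface integral *)

Section sphere_derivative.
Context {R : realType}.
Local Notation mu := (@tuple_lebesgue R).
Implicit Types n : nat.

Lemma is_derive_sphere_Rint n (h h' : R -> 'rV[R]_n -> R) (a b x C : R) :
  x \in `]a, b[ ->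
  (forall y, y \in `]a, b[ -> sphere_fun (h y)) ->
  (forall y v, y \in `]a, b[ -> enorm v = 1 -> is_derive y 1 (h ^~ v) (h' y v)) ->
  (forall y v, y \in `]a, b[ -> enorm v = 1 -> `|h' y v| <= C) ->
  is_derive x 1 (fun y => sphere_Rint (h y)) (sphere_Rint (h' x)).
Proof.
move=> xab sh dh h'C.
have mp := @measurable_pball R n.
pose f y t := h y (direction t : 'rV[R]_n).
have dE y t : y \in `]a, b[ -> pball t -> partial1of2 f y t = h' y (direction t).
  move=> yab tp; rewrite partial1of2E.
  by have [_ ->] := dh y _ yab (direction_sphere tp).
have Hint y : `]a, b[%classic y -> (mu n).-integrable (@pball R n) (EFin \o f y).
  by move=> yab; exact: (integrable_sphere_fun (sh y yab)).
have Hder y t : `]a, b[%classic y -> pball t -> derivable (f ^~ t) y 1.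
  by move=> yab tp; have [] := dh y _ yab (direction_sphere tp).
have HG : (mu n).-integrable (@pball R n) (EFin \o (fun _ => `|C|)).
  exact: (integrable_sphere_fun (sphere_fun_cst n `|C|)).
have Hub y t : `]a, b[%classic y -> pball t -> `|partial1of2 f y t| <= `|C|.
  move=> yab tp; rewrite dE//; apply: (le_trans _ (ler_norm _)).
  by apply: h'C => //; exact: direction_sphere.
have D1 := derivable_under_integral mp xab Hint Hder (fun _ => normr_ge0 C) HG Hub.
have D2 := differentiation_under_integral mp xab Hint Hder (fun _ => normr_ge0 C) HG Hub.
have -> : sphere_Rint (h' x) = n%:R * (\int[mu n]_(t in @pball R n) partial1of2 f x t).
  congr (_ * _); apply: eq_Rintegral => t; rewrite inE => tp.
  by rewrite dE.
rewrite -D2 derive1E.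
have D3 := DeriveDef D1 erefl.
have := is_deriveZ n%:R D3.
by [].
Qed.

End sphere_derivative.

(** * Moments and integration by parts on the sphere *)

Section reflections.
Context {R : realType}.
Implicit Types n : nat.

Definition householder n (a : 'rV[R]_n) : 'M[R]_n := 1%:M - 2 *: (a^T *m a).

Lemma mulmx_householder n (a v : 'rV[R]_n) :
  v *m householder a = v - (2 * dot v a) *: a.
Proof.
rewrite /householder mulmxBr mulmx1 -scalemxAr mulmxA.
by rewrite [v *m a^T]mx11_scalar mul_scalar_mx scalerA.
Qed.

Lemma householder_orthogonal n (a : 'rV[R]_n) : enorm a = 1 ->
  householder a *m (householder a)^T = 1%:M.
Proof.
move=> /enorm1P a1.
have -> : (householder a)^T = householder a.
  by rewrite /householder linearB/= linearZ/= trmx_mul trmxK trmx1.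
rewrite [X in _ *m X]/householder mulmxBr mulmx1 -scalemxAr.
have aa : a *m a^T = 1%:M by rewrite [LHS]mx11_scalar -/(dot a a) a1.
have -> : householder a *m (a^T *m a) = - (a^T *m a).
  rewrite /householder mulmxBl mul1mx -scalemxAl mulmxA -(mulmxA a^T) aa mulmx1.
  by rewrite scaler_nat mulr2n opprD addNKr.
by rewrite /householder scalerN opprK subrK.
Qed.

Definition unit_row n (i : 'I_n) : 'rV[R]_n := delta_mx ord0 i.

Lemma dot_unit_row n (v : 'rV[R]_n) i : dot v (unit_row i) = v ord0 i.
Proof.
rewrite dotE (bigD1 i)//= big1 ?addr0; first by rewrite mxE !eqxx mulr1.
by move=> j ji; rewrite mxE (negbTE ji) andbF mulr0.
Qed.

Lemma enorm_unit_row n (i : 'I_n) : enorm (unit_row i) = 1.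
Proof. by apply/enorm1P; rewrite dot_unit_row mxE !eqxx. Qed.

Lemma unit_row_mulmx n (i : 'I_n) (Q : 'M[R]_n) k : (unit_row i *m Q) ord0 k = Q i k.
Proof.
by rewrite -rowE mxE.
Qed.

Lemma dotDl n (u v w : 'rV[R]_n) : dot (u + v) w = dot u w + dot v w.
Proof. by rewrite /dot mulmxDl mxE. Qed.

Lemma dotZl n c (u v : 'rV[R]_n) : dot (c *: u) v = c * dot u v.
Proof. by rewrite /dot -scalemxAl mxE. Qed.

Lemma dotZr n c (u v : 'rV[R]_n) : dot u (c *: v) = c * dot u v.
Proof. by rewrite dotC dotZl dotC. Qed.

Lemma dotDr n (u v w : 'rV[R]_n) : dot w (u + v) = dot w u + dot w v.
Proof. by rewrite dotC dotDl !(dotC w). Qed.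

(** Two distinct unit vectors are exchanged by the reflection along their difference. *)
Lemma orthogonal_transitive n (w : 'rV[R]_n) (i : 'I_n) : enorm w = 1 ->
  exists2 Q : 'M[R]_n, Q *m Q^T = 1%:M & unit_row i *m Q = w.
Proof.
move=> w1; have [wi|wi] := eqVneq w (unit_row i).
  by exists 1%:M; rewrite ?trmx1 mulmx1.
pose b := unit_row i - w.
(* Equality of the two norms enters here: it makes the reflection subtract exactly [b] from
   [unit_row i]. *)
have bb : dot b b = 2 * dot (unit_row i) b.
  have := iffLR (enorm1P _) w1; have := iffLR (enorm1P _) (enorm_unit_row i).
  rewrite /b -(scaleN1r w) !dotDl !dotDr !dotZl !dotZr (dotC w (unit_row i)) => -> ->.
  by ring.
have b0 : enorm b != 0.
  apply: contra wi => /eqP b0; apply/eqP/rowP => k.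
  have := le_coord_enorm b k; rewrite b0 normr_le0 /b mxE [X in _ + X]mxE subr_eq0.
  by move=> /eqP.
exists (householder ((enorm b)^-1 *: b)).
  by apply: householder_orthogonal; rewrite enormZ ger0_norm ?invr_ge0 ?enorm_ge0// mulVf.
rewrite mulmx_householder dotZr mulrCA -bb -sqr_enorm scalerA.
have -> : (enorm b)^-1 * enorm b ^+ 2 * (enorm b)^-1 = 1.
  by rewrite expr2 mulrA mulVf// mul1r mulfV.
by rewrite scale1r /b opprB addrC subrK.
Qed.

End reflections.

(** * Uniform moments, integration by parts, zonal functions *)

Section sphere_moments.
Context {R : realType}.
Implicit Types n : nat.

Definition sphere_mass n : R := sphere_Rint (fun _ : 'rV[R]_n => 1).

Lemma sphere_Rint_cst n (c : R) :
  sphere_Rint (fun _ : 'rV[R]_n => c) = c * sphere_mass n.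
Proof.
rewrite /sphere_mass -sphere_RintZ; last exact: sphere_fun_cst.
by under [in RHS]eq_sphere_Rint do rewrite mulr1.
Qed.

Lemma sphere_Rint_reflect_coord n (i : 'I_n) (g : 'rV[R]_n -> R) :
  sphere_fun g ->
  sphere_Rint (fun v : 'rV[R]_n => g (v - (2 * v ord0 i) *: unit_row i)) = sphere_Rint g.
Proof.
move=> sg; rewrite -(sphere_Rint_mulmx (householder_orthogonal (enorm_unit_row i)) sg).
by apply: eq_sphere_Rint => v _; rewrite mulmx_householder dot_unit_row.
Qed.

Lemma reflect_coordE n (i j : 'I_n) (v : 'rV[R]_n) :
  (v - (2 * v ord0 i) *: unit_row i) ord0 j = if j == i then - v ord0 i else v ord0 j.
Proof.
rewrite !mxE /=; case: eqP => [->|] /=; last by rewrite mulr0 subr0.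
by rewrite mulr1; ring.
Qed.

Lemma sphere_Rint_odd n (i : 'I_n) (g : 'rV[R]_n -> R) : sphere_fun g ->
  (forall v : 'rV[R]_n, g (v - (2 * v ord0 i) *: unit_row i) = - g v) -> sphere_Rint g = 0.
Proof.
move=> sg gN; have := sphere_Rint_reflect_coord i sg.
under eq_sphere_Rint do rewrite gN -mulN1r.
rewrite sphere_RintZ// mulN1r => /eqP; rewrite eq_sym -subr_eq0 opprK -mulr2n.
by rewrite mulrn_eq0 => /eqP.
Qed.

Lemma sphere_Rint_coord n (i : 'I_n) : sphere_Rint (fun v : 'rV[R]_n => v ord0 i) = 0.
Proof.
apply: (sphere_Rint_odd (i := i) (sphere_fun_coord i)) => v.
by rewrite reflect_coordE eqxx.
Qed.

(** Mixed products are odd under a sign change of one coordinate. The squares have equal integrals,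
    since an orthogonal map carries one axis to another, and they sum to the total mass because [v]
    has norm 1. *)
Lemma sphere_Rint_coordM n (i j : 'I_n) : (0 < n)%N ->
  sphere_Rint (fun v : 'rV[R]_n => v ord0 i * v ord0 j) =
  n%:R^-1 * (i == j)%:R * sphere_mass n.
Proof.
move=> n0.
have sM k l : sphere_fun (fun v : 'rV[R]_n => v ord0 k * v ord0 l).
  by apply: sphere_funM; exact: sphere_fun_coord.
have [->|ij] := eqVneq i j; last first.
  rewrite mulr0 mul0r; apply: (sphere_Rint_odd (i := i) (sM i j)) => v.
  by rewrite !reflect_coordE eqxx eq_sym (negbTE ij) mulNr.
have same k : sphere_Rint (fun v : 'rV[R]_n => v ord0 k * v ord0 k) =
    sphere_Rint (fun v : 'rV[R]_n => v ord0 j * v ord0 j).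
  have [Q QQ kQ] := orthogonal_transitive k (@enorm_unit_row R n j).
  rewrite -(sphere_Rint_mulmx QQ (sM j j)).
  have QQ' := mulmx1C QQ.
  apply: eq_sphere_Rint => v _.
  suff -> : (v *m Q) ord0 j = v ord0 k by [].
  by rewrite -[LHS]dot_unit_row -kQ dot_mulmx// dot_unit_row.
rewrite mulr1 -[LHS](mulKf (_ : n%:R != 0)) ?pnatr_eq0 -?lt0n//; congr (_ * _).
transitivity (\sum_(k < n) sphere_Rint (fun v : 'rV[R]_n => v ord0 k * v ord0 k)).
  by rewrite (eq_bigr _ (fun k _ => same k)) sumr_const card_ord mulr_natl.
rewrite -sphere_Rint_sum//; apply: eq_sphere_Rint => v /enorm1P <-.
by rewrite dotE.
Qed.

(* Integration by parts on the sphere: the reflections in the plane (i, j) form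
   a one-parameter family along which the integral of [v_j f(v_i)] is constant. *)
Lemma sphere_stein_coord n (i j : 'I_n) (f f' : R -> R) (C : R) : i != j ->
  measurable_fun setT f -> measurable_fun setT f' ->
  (forall t : R, `|t| <= 1 -> is_derive t 1 f (f' t)) ->
  (forall t : R, `|t| <= 1 -> `|f t| <= C) ->
  (forall t : R, `|t| <= 1 -> `|f' t| <= C) ->
  sphere_Rint (fun v : 'rV[R]_n => v ord0 j ^+ 2 * f' (v ord0 i)) =
  sphere_Rint (fun v : 'rV[R]_n => v ord0 i * f (v ord0 i)).
Proof.
move=> ij mf mf' df fC f'C.
have C0 : 0 <= C by apply: le_trans (fC 0 _); rewrite ?normr_ge0 ?normr0.
have le1 (v : 'rV[R]_n) k : enorm v = 1 -> `|v ord0 k| <= 1.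
  by move=> <-; exact: le_coord_enorm.
(* These are cos 2p and sin 2p, the matrix entries of the reflection along [a p] in the plane (i,
   j); hence [A' = - 2 B] and [B' = 2 A]. *)
pose A (p : R) := 1 - 2 * (sin p * sin p); pose B (p : R) := 2 * (sin p * cos p).
have dA (p : R) : is_derive p 1 A (- 2 * B p).
  rewrite /A /B; apply: is_derive_eq.
  by rewrite /GRing.scale/=; ring.
have dB (p : R) : is_derive p 1 B (2 * A p).
  rewrite /A /B; apply: is_derive_eq.
  rewrite /GRing.scale/=.
  have := cos2Dsin2 p; rewrite !expr2 => cs; rewrite -[X in X - _]cs; ring.
pose a (p : R) : 'rV[R]_n := cos p *: unit_row j - sin p *: unit_row i.
have a1 p : enorm (a p) = 1.
  apply/enorm1P; rewrite /a -scaleNr !(dotDl, dotDr, dotZl, dotZr) !dot_unit_row !mxE !eqxx.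
  rewrite (negbTE ij) eq_sym (negbTE ij) /=.
  by have := cos2Dsin2 p; rewrite !expr2 => cs; rewrite -[RHS]cs; ring.
have vi p (v : 'rV[R]_n) : (v *m householder (a p)) ord0 i = A p * v ord0 i + B p * v ord0 j.
  rewrite mulmx_householder /a -!scaleNr dotDr !dotZr !dot_unit_row !mxE !eqxx.
  rewrite (negbTE ij) /= /A /B /GRing.scale/=; ring.
have vj p (v : 'rV[R]_n) : (v *m householder (a p)) ord0 j = B p * v ord0 i - A p * v ord0 j.
  rewrite mulmx_householder /a -!scaleNr dotDr !dotZr !dot_unit_row !mxE !eqxx.
  rewrite eq_sym (negbTE ij) /A /B /GRing.scale/=.
  have := cos2Dsin2 p; rewrite !expr2 => cs.
  have -> : sin p * sin p = 1 - cos p * cos p by rewrite -cs; ring.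
  by ring.
pose h p (v : 'rV[R]_n) :=
  (B p * v ord0 i - A p * v ord0 j) * f (A p * v ord0 i + B p * v ord0 j).
pose h' p (v : 'rV[R]_n) :=
  2 * ((A p * v ord0 i + B p * v ord0 j) * f (A p * v ord0 i + B p * v ord0 j)
     - (B p * v ord0 i - A p * v ord0 j) ^+ 2 * f' (A p * v ord0 i + B p * v ord0 j)).
have sf : sphere_fun (fun v : 'rV[R]_n => f (v ord0 i)).
  by apply: (sphere_fun_comp mf (sphere_fun_coord i) (C := C)) => v v1; exact/fC/le1.
have sf' : sphere_fun (fun v : 'rV[R]_n => f' (v ord0 i)).
  by apply: (sphere_fun_comp mf' (sphere_fun_coord i) (C := C)) => v v1; exact/f'C/le1.
have sh0 : sphere_fun (fun v : 'rV[R]_n => v ord0 j * f (v ord0 i)).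
  by apply: sphere_funM => //; exact: sphere_fun_coord.
have hE p v : h p v = (v *m householder (a p)) ord0 j * f ((v *m householder (a p)) ord0 i).
  by rewrite vi vj.
have sh p : sphere_fun (h p).
  apply: eq_sphere_fun (sphere_fun_mulmx (householder_orthogonal (a1 p)) sh0) => v _.
  by rewrite hE.
have Sh p : sphere_Rint (h p) = sphere_Rint (fun v : 'rV[R]_n => v ord0 j * f (v ord0 i)).
  rewrite -(sphere_Rint_mulmx (householder_orthogonal (a1 p)) sh0).
  by apply: eq_sphere_Rint => v _; rewrite hE.
have mle1 p (v : 'rV[R]_n) k : enorm v = 1 -> `|(v *m householder (a p)) ord0 k| <= 1.
  by move=> v1; apply: le1; rewrite enorm_mulmx// householder_orthogonal.
have dh (p : R) v : enorm v = 1 -> is_derive p 1 (h ^~ v) (h' p v).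
  move=> v1; rewrite /h /h'.
  have d1 : is_derive p 1 (fun p : R => A p * v ord0 i + B p * v ord0 j)
      (- 2 * (B p * v ord0 i - A p * v ord0 j)).
    by apply: is_derive_eq; rewrite /GRing.scale/=; ring.
  have d2 : is_derive p 1 (fun p : R => f (A p * v ord0 i + B p * v ord0 j))
      (- 2 * (B p * v ord0 i - A p * v ord0 j) * f' (A p * v ord0 i + B p * v ord0 j)).
    have dfp : is_derive (A p * v ord0 i + B p * v ord0 j) 1 f
        (f' (A p * v ord0 i + B p * v ord0 j)).
      by apply: df; rewrite -vi; exact: mle1.
    rewrite mulrC; exact: (@is_derive1_comp R f
      (fun p : R => A p * v ord0 i + B p * v ord0 j) p _ _ dfp d1).
  have d3 : is_derive p 1 (fun p : R => B p * v ord0 i - A p * v ord0 j)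
      (2 * (A p * v ord0 i + B p * v ord0 j)).
    by apply: is_derive_eq; rewrite /GRing.scale/=; ring.
  by apply: is_derive_eq; rewrite /GRing.scale/=; ring.
have h'C p v : enorm v = 1 -> `|h' p v| <= 2 * (C + C).
  move=> v1; rewrite /h' -vi -vj normrM ger0_norm// ler_wpM2l//.
  apply: (le_trans (ler_normB _ _)); apply: lerD; rewrite normrM.
    by rewrite -[leRHS]mul1r ler_pM ?mle1// fC// mle1.
  rewrite -[leRHS]mul1r ler_pM ?normrX ?exprn_ile1 ?mle1//.
  by rewrite f'C// mle1.
have D : is_derive (0 : R) 1 (fun p : R => sphere_Rint (h p)) (sphere_Rint (h' 0)).
  apply: (@is_derive_sphere_Rint _ _ h h' (-1) 1 0 (2 * (C + C)) _
    (fun y _ => sh y) (fun y v _ v1 => dh y v v1) (fun y v _ v1 => h'C y v v1)).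
  by rewrite in_itv/= ltrN10 ltr01.
(* By [Sh] the integral of [h p] does not depend on [p]. At [p = 0] one has [A = 1] and [B = 0], and
   [h' 0] is twice the difference of the two integrands. *)
have D0 : sphere_Rint (h' 0) = 0.
  have [_ <-] := D; rewrite -derive1E.
  rewrite (_ : (fun p => _) =
      cst (sphere_Rint (fun v : 'rV[R]_n => v ord0 j * f (v ord0 i)))).
    by rewrite derive1_cst.
  by apply/funext => p; rewrite Sh.
have A0 : A 0 = 1 by rewrite /A sin0 mul0r mulr0 subr0.
have B0 : B 0 = 0 by rewrite /B sin0 mul0r mulr0.
have s1 : sphere_fun (fun v : 'rV[R]_n => v ord0 i * f (v ord0 i)).
  by apply: sphere_funM => //; exact: sphere_fun_coord.
have s2 : sphere_fun (fun v : 'rV[R]_n => v ord0 j ^+ 2 * f' (v ord0 i)).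
  under eq_fun do rewrite expr2.
  by apply: sphere_funM => //; apply: sphere_funM; exact: sphere_fun_coord.
apply/eqP; rewrite eq_sym -subr_eq0 -sphere_RintB//.
have : 2 * sphere_Rint (fun v : 'rV[R]_n =>
    v ord0 i * f (v ord0 i) - v ord0 j ^+ 2 * f' (v ord0 i)) = 0.
  rewrite -sphere_RintZ; last exact: sphere_funB.
  rewrite -[RHS]D0; apply: eq_sphere_Rint => v _.
  by rewrite /h' A0 B0 !mul0r !mul1r addr0 sub0r sqrrN.
by move=> /eqP; rewrite mulf_eq0 pnatr_eq0.
Qed.

(** Summation of [sphere_stein_coord] over the [n - 1] indices [j != i]: on the sphere the squares
    of the other coordinates add up to [1 - v_i^2]. *)
Lemma sphere_stein n (i : 'I_n) (f f' : R -> R) (C : R) :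
  measurable_fun setT f -> measurable_fun setT f' ->
  (forall t : R, `|t| <= 1 -> is_derive t 1 f (f' t)) ->
  (forall t : R, `|t| <= 1 -> `|f t| <= C) ->
  (forall t : R, `|t| <= 1 -> `|f' t| <= C) ->
  sphere_Rint (fun v : 'rV[R]_n => (1 - v ord0 i ^+ 2) * f' (v ord0 i)) =
  n.-1%:R * sphere_Rint (fun v : 'rV[R]_n => v ord0 i * f (v ord0 i)).
Proof.
move=> mf mf' df fC f'C.
have sf' : sphere_fun (fun v : 'rV[R]_n => f' (v ord0 i)).
  apply: (sphere_fun_comp mf' (sphere_fun_coord i) (C := C)) => v v1.
  by apply: f'C; rewrite -v1 le_coord_enorm.
pose g (j : 'I_n) (v : 'rV[R]_n) := if j == i then 0 else v ord0 j ^+ 2 * f' (v ord0 i).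
have sg j : sphere_fun (g j).
  rewrite /g; case: (j == i); first exact: sphere_fun_cst.
  under eq_fun do rewrite expr2.
  by apply: sphere_funM => //; apply: sphere_funM; exact: sphere_fun_coord.
transitivity (sphere_Rint (fun v : 'rV[R]_n => \sum_j g j v)).
  apply: eq_sphere_Rint => v /enorm1P; rewrite dotE (bigD1 i)//= => <-.
  have gi : g i v = 0 by rewrite /g eqxx.
  rewrite [RHS](bigD1 i)//= gi add0r expr2 addrAC subrr add0r mulr_suml.
  by apply: eq_bigr => j ji; rewrite /g (negbTE ji) expr2.
have gi : sphere_Rint (g i) = 0 by rewrite /g eqxx sphere_Rint_cst mul0r.
rewrite sphere_Rint_sum// (bigD1 i)//= gi add0r.
rewrite (eq_bigr (fun=> sphere_Rint (fun v : 'rV[R]_n => v ord0 i * f (v ord0 i)))).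
  by rewrite sumr_const cardC1 card_ord mulr_natl.
move=> j ji; rewrite /g (negbTE ji).
by apply: (sphere_stein_coord (C := C)) => //; rewrite eq_sym.
Qed.

Lemma sphere_Rint_zonal n (i : 'I_n) (w : 'rV[R]_n) (f : R -> R) (C : R) :
  enorm w = 1 -> measurable_fun setT f ->
  (forall t : R, `|t| <= 1 -> `|f t| <= C) ->
  sphere_Rint (fun v => f (dot w v)) = sphere_Rint (fun v : 'rV[R]_n => f (v ord0 i)).
Proof.
move=> w1 mf fC; have [Q QQ iQ] := orthogonal_transitive i w1.
rewrite -[LHS](sphere_Rint_mulmx QQ); last first.
  apply: (sphere_fun_comp mf (sphere_fun_dot w) (C := C)) => v v1.
  by apply: fC; exact: dot_sphere_le1.
apply: eq_sphere_Rint => v _.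
by rewrite -iQ dot_mulmx// dotC dot_unit_row.
Qed.

(** Once [w] is rotated to axis [i], the factor [v_k] becomes the sum of the [Q l k * v_l]. Terms
    with [l != i] are odd in [v_l] and vanish; the remaining coefficient [Q i k] is [w_k]. *)
Lemma sphere_Rint_zonal_coord n (i k : 'I_n) (w : 'rV[R]_n) (f : R -> R) (C : R) :
  enorm w = 1 -> measurable_fun setT f ->
  (forall t : R, `|t| <= 1 -> `|f t| <= C) ->
  sphere_Rint (fun v => v ord0 k * f (dot w v)) =
  w ord0 k * sphere_Rint (fun v : 'rV[R]_n => v ord0 i * f (v ord0 i)).
Proof.
move=> w1 mf fC; have [Q QQ iQ] := orthogonal_transitive i w1.
have sf : sphere_fun (fun v : 'rV[R]_n => f (v ord0 i)).
  apply: (sphere_fun_comp mf (sphere_fun_coord i) (C := C)) => v v1.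
  by apply: fC; rewrite -v1 le_coord_enorm.
rewrite -[LHS](sphere_Rint_mulmx QQ); last first.
  apply: sphere_funM; first exact: sphere_fun_coord.
  apply: (sphere_fun_comp mf (sphere_fun_dot w) (C := C)) => v v1.
  by apply: fC; exact: dot_sphere_le1.
have sl l : sphere_fun (fun v : 'rV[R]_n => v ord0 l * f (v ord0 i)).
  by apply: sphere_funM => //; exact: sphere_fun_coord.
transitivity (sphere_Rint (fun v : 'rV[R]_n => \sum_l Q l k * (v ord0 l * f (v ord0 i)))).
  apply: eq_sphere_Rint => v _; rewrite -iQ dot_mulmx// dotC dot_unit_row mxE mulr_suml.
  by apply: eq_bigr => l _; ring.
rewrite sphere_Rint_sum; last by move=> l; exact: sphere_funZ.
rewrite (bigD1 i)//= big1 ?addr0 => [|l li]; first by rewrite sphere_RintZ// -iQ unit_row_mulmx.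
rewrite sphere_RintZ// (sphere_Rint_odd (i := l) (sl l)) ?mulr0// => v.
by rewrite !reflect_coordE eqxx eq_sym (negbTE li) mulNr.
Qed.

End sphere_moments.

(** * The Poisson kernel *)

Section poisson_kernel.
Context {R : realType}.
Implicit Types (r t p q : R) (n : nat).

(** For unit vectors [v], [w] with inner product [t], the base is the squared distance from [v] to
    [r w]. *)
Definition poisson_pow p r t : R := (1 - 2 * r * t + r ^+ 2) `^ (- p).

(** The bound is uniform over [|r| <= q], as domination requires when differentiating in [r].
    Negative [r] are included so that derivatives exist on both sides of 0. *)
Lemma poisson_base_ge q r t : `|r| <= q -> q < 1 -> `|t| <= 1 ->
  (1 - q) ^+ 2 <= 1 - 2 * r * t + r ^+ 2.
Proof.
move=> rq q1 t1.
have rt : r * t <= `|r|.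
  by rewrite (le_trans (ler_norm _))// normrM ler_piMr.
have -> : 1 - 2 * r * t + r ^+ 2 = (1 - `|r|) ^+ 2 + 2 * (`|r| - r * t).
  by rewrite -(real_normK (num_real r)); ring.
rewrite -[leLHS]addr0 lerD ?mulr_ge0 ?subr_ge0//.
by rewrite lerXn2r ?nnegrE ?subr_ge0 ?lerB// ?(le_trans rq)// ltW.
Qed.

Lemma poisson_base_gt0 r t : `|r| < 1 -> `|t| <= 1 -> 0 < 1 - 2 * r * t + r ^+ 2.
Proof.
move=> r1 t1; apply: lt_le_trans (poisson_base_ge (lexx _) r1 t1).
by rewrite exprn_gt0// subr_gt0.
Qed.

Lemma poisson_pow_bound p q r t : 0 <= p -> `|r| <= q -> q < 1 -> `|t| <= 1 ->
  `|poisson_pow p r t| <= ((1 - q) ^+ 2) `^ (- p).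
Proof.
move=> p0 rq q1 t1; rewrite ger0_norm ?powR_ge0// /poisson_pow !powRN.
have q0 : 0 < (1 - q) ^+ 2 by rewrite exprn_gt0// subr_gt0.
have qD := poisson_base_ge rq q1 t1.
rewrite lef_pV2 ?posrE ?powR_gt0 ?(lt_le_trans q0)//.
by rewrite ge0_ler_powR// nnegrE ltW// (lt_le_trans q0).
Qed.

Lemma poisson_powS p r t : `|r| < 1 -> `|t| <= 1 ->
  poisson_pow p r t = (1 - 2 * r * t + r ^+ 2) * poisson_pow (p + 1) r t.
Proof.
move=> r1 t1; have D0 := poisson_base_gt0 r1 t1.
rewrite /poisson_pow (opprD p 1) powRD; last by rewrite (gt_eqF D0) implybT.
by rewrite powR_inv1 ?ltW// mulrCA mulfV ?mulr1// gt_eqF.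
Qed.

Lemma measurable_poisson_pow p r : measurable_fun setT (poisson_pow p r).
Proof.
rewrite /poisson_pow.
apply: (@measurableT_comp _ _ _ _ _ _ (@powR R ^~ (- p))); first exact: measurable_powR.
by apply: measurable_funD => //; apply: measurable_funB => //; exact: measurable_funM.
Qed.

Lemma is_derive_poisson_pow_t p r t : `|r| < 1 -> `|t| <= 1 ->
  is_derive t 1 (poisson_pow p r) (2 * p * r * poisson_pow (p + 1) r t).
Proof.
move=> r1 t1; have D0 := poisson_base_gt0 r1 t1.
have d1 : is_derive t 1 (fun t => 1 - 2 * r * t + r ^+ 2) (- 2 * r).
  by apply: is_derive_eq; rewrite /GRing.scale/=; ring.
have d2 := is_derive1_powR (- p) D0.
apply: (is_derive_eq (@is_derive1_comp R (@powR R ^~ (- p))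
  (fun t => 1 - 2 * r * t + r ^+ 2) t _ _ d2 d1)).
by rewrite /poisson_pow (opprD p 1); ring.
Qed.

Lemma is_derive_poisson_pow_r p r t : `|r| < 1 -> `|t| <= 1 ->
  is_derive r 1 (fun r => poisson_pow p r t) (2 * p * (t - r) * poisson_pow (p + 1) r t).
Proof.
move=> r1 t1; have D0 := poisson_base_gt0 r1 t1.
have d1 : is_derive r 1 (fun r => 1 - 2 * r * t + r ^+ 2) (2 * r - 2 * t).
  under eq_fun do rewrite expr2.
  by apply: is_derive_eq; rewrite /GRing.scale/=; ring.
have d2 := is_derive1_powR (- p) D0.
apply: (is_derive_eq (@is_derive1_comp R (@powR R ^~ (- p))
  (fun r => 1 - 2 * r * t + r ^+ 2) r _ _ d2 d1)).
by rewrite /poisson_pow (opprD p 1); ring.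
Qed.

Lemma sphere_fun_poisson_pow n (i : 'I_n) p r : 0 <= p -> `|r| < 1 ->
  sphere_fun (fun v : 'rV[R]_n => poisson_pow p r (v ord0 i)).
Proof.
move=> p0 r1; apply: (sphere_fun_comp (measurable_poisson_pow p r) (sphere_fun_coord i)
  (C := ((1 - `|r|) ^+ 2) `^ (- p))) => v v1.
by apply: poisson_pow_bound => //; rewrite -v1 le_coord_enorm.
Qed.

(** Mean value theorem on [[0, r]]. Differentiability at 0 supplies continuity at the endpoint,
    while the vanishing of the derivative is asked only for [x > 0], where a division by [x] is
    allowed. *)
Lemma derive0_eq_at0 (f f' : R -> R) r : 0 < r -> r < 1 ->
  (forall x : R, `|x| < 1 -> is_derive x 1 f (f' x)) ->
  (forall x, 0 < x -> x < 1 -> f' x = 0) -> f r = f 0.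
Proof.
move=> r0 r1 df f'0.
have in1 x : 0 <= x <= r -> `|x| < 1.
  by move=> /andP[x0 xr]; rewrite ger0_norm// (le_lt_trans xr).
have [x||x xr E] := @MVT R f f' 0 r r0.
- by rewrite in_itv/= => /andP[x0 xr]; apply: df; apply: in1; rewrite !ltW.
- apply: derivable_within_continuous => x; rewrite in_itv/= => xr.
  by have [] := df x (in1 x xr).
move: xr; rewrite in_itv/= => /andP[x0 xr].
by move: E; rewrite f'0 ?mul0r// ?(lt_trans xr)// => /eqP; rewrite subr_eq0 => /eqP.
Qed.

Section zonal.
Variables (n : nat) (i : 'I_n).
Hypothesis n2 : (2 <= n)%N.
Local Notation s := (n%:R / 2 : R).
Local Notation S g := (sphere_Rint (fun v : 'rV[R]_n => g (v ord0 i))).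
Local Notation W := (@sphere_mass R n).

Let s0 : 0 <= s. Proof. by rewrite divr_ge0. Qed.
Let s1 : 0 <= s - 1.
Proof. by rewrite subr_ge0 ler_pdivlMr// mul1r ler_nat. Qed.
Let sS : 0 <= s + 1. Proof. by rewrite addr_ge0. Qed.
Let le1 (v : 'rV[R]_n) : enorm v = 1 -> `|v ord0 i| <= 1.
Proof. by move=> <-; exact: le_coord_enorm. Qed.

Let M r := S (fun t => (1 - r * t) * poisson_pow s r t).
Let N r := S (fun t => poisson_pow (s - 1) r t).

(** [sphere_stein] for [D^(-s)], whose derivative in [t] carries the factor [2 s r = n r]. The sum
    [C1 + C2] bounds both the function and its derivative. *)
Let stein r : `|r| < 1 ->
  S (fun t => (1 - t ^+ 2) * (n%:R * r * poisson_pow (s + 1) r t)) =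
  n.-1%:R * S (fun t => t * poisson_pow s r t).
Proof.
move=> r1.
pose C1 := ((1 - `|r|) ^+ 2) `^ (- s).
pose C2 := n%:R * `|r| * ((1 - `|r|) ^+ 2) `^ (- (s + 1)).
have C10 : 0 <= C1 by rewrite powR_ge0.
have C20 : 0 <= C2 by rewrite !mulr_ge0// powR_ge0.
apply: (@sphere_stein _ _ _ (poisson_pow s r)
  (fun t => n%:R * r * poisson_pow (s + 1) r t) (C1 + C2)).
- exact: measurable_poisson_pow.
- by apply: measurable_funM => //; exact: measurable_poisson_pow.
- move=> t t1; apply: is_derive_eq (is_derive_poisson_pow_t s r1 t1) _.
  by congr (_ * _ * _); rewrite mulrC divfK.
- by move=> t t1; rewrite (le_trans (poisson_pow_bound _ (lexx _) r1 t1))// lerDl.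
- move=> t t1; rewrite (@le_trans _ _ C2) ?lerDr// !normrM (ger0_norm (ler0n R n)).
  by rewrite ler_wpM2l ?mulr_ge0//; exact: poisson_pow_bound.
Qed.

Let sphere_fun_lin (a b : R) p r : 0 <= p -> `|r| < 1 ->
  sphere_fun (fun v : 'rV[R]_n => (a + b * v ord0 i) * poisson_pow p r (v ord0 i)).
Proof.
move=> p0 r1; apply: sphere_funM; last exact: sphere_fun_poisson_pow.
apply: sphere_funD; first exact: sphere_fun_cst.
by apply: sphere_funZ; exact: sphere_fun_coord.
Qed.

(** Provides the interval []-q, q[] around [r] on which the base stays away from 0 uniformly. *)
Let mid r : `|r| < 1 -> exists2 q, `|r| < q & q < 1.
Proof. by move=> r1; exists ((`|r| + 1) / 2); [rewrite midf_lt|rewrite midf_lt]. Qed.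

(** Writing [D^(-s) = D * D^(-s-1)], the identity [(1 - r t) (t - r) = t D - r (1 - t^2)] turns the
    derivative of the integrand into [m], the difference of the two integrands compared by
    [stein]. *)
Let derM (r : R) : `|r| < 1 -> is_derive r 1 M 0.
Proof.
move=> r1; have [q rq q1] := mid r1.
have inq y : y \in `](- q), q[ -> `|y| < q by rewrite in_itv/= -ltr_norml.
have inq1 y : y \in `](- q), q[ -> `|y| < 1 by move=> /inq /lt_trans; apply.
pose m y t := n.-1%:R * (t * poisson_pow s y t)
  - (1 - t ^+ 2) * (n%:R * y * poisson_pow (s + 1) y t).
pose C p := ((1 - q) ^+ 2) `^ (- p).
have C0 p : 0 <= C p by rewrite powR_ge0.
have sf1 y : `|y| < 1 -> sphere_fun (fun v : 'rV[R]_n => v ord0 i * poisson_pow s y (v ord0 i)).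
  move=> y1; apply: sphere_funM; first exact: sphere_fun_coord.
  exact: sphere_fun_poisson_pow.
have sf2 y : `|y| < 1 -> sphere_fun (fun v : 'rV[R]_n =>
    (1 - v ord0 i ^+ 2) * (n%:R * y * poisson_pow (s + 1) y (v ord0 i))).
  move=> y1; apply: sphere_funM.
    apply: sphere_funB; first exact: sphere_fun_cst.
    by under eq_fun do rewrite expr2; apply: sphere_funM; exact: sphere_fun_coord.
  by apply: sphere_funZ; exact: sphere_fun_poisson_pow.
have -> : (0 : R) = S (m r).
  rewrite (sphere_RintB (sphere_funZ _ (sf1 r r1)) (sf2 r r1)).
  by rewrite (sphere_RintZ _ (sf1 r r1)) stein// subrr.
apply: (@is_derive_sphere_Rint _ _
  (fun y v => (1 - y * v ord0 i) * poisson_pow s y (v ord0 i))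
  (fun y v => m y (v ord0 i)) (- q) q r (n.-1%:R * C s + n%:R * C (s + 1))).
- by rewrite in_itv/= -ltr_norml.
- move=> y yq; have := sphere_fun_lin 1 (- y) s0 (inq1 y yq).
  by under eq_fun do rewrite mulNr.
- move=> y v yq v1; have y1 := inq1 y yq; have t1 := le1 v1.
  move: (v ord0 i) t1 => t t1.
  have d1 := is_derive_poisson_pow_r s y1 t1.
  have d2 : is_derive y 1 (fun y => 1 - y * t) (- t).
    by apply: is_derive_eq; rewrite /GRing.scale/=; ring.
  apply: is_derive_eq; rewrite /GRing.scale/= /m (poisson_powS s y1 t1).
  have -> : 2 * s = n%:R by rewrite mulrC divfK.
  have -> : n.-1%:R = n%:R - 1 :> R by rewrite -subn1 natrB// ltnW.
  by ring.
- move=> y v yq v1; have y1 := inq1 y yq; have t1 := le1 v1.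
  move: (v ord0 i) t1 => t t1; have yq' := ltW (inq _ yq).
  apply: (le_trans (ler_normB _ _)); apply: lerD.
    rewrite !normrM ger0_norm// ler_wpM2l// -[leRHS]mul1r ler_pM//.
    exact: poisson_pow_bound.
  rewrite -[leRHS]mul1r normrM ler_pM//.
    have t2 : 0 <= t ^+ 2 <= 1 by rewrite sqr_ge0 -(real_normK (num_real t)) exprn_ile1.
    by move: t2 => /andP[t20 t21]; rewrite ger0_norm ?subr_ge0// lerBlDr lerDl.
  rewrite -mulrA normrM ger0_norm// ler_wpM2l// -[leRHS]mul1r normrM ler_pM//; first exact: ltW.
  exact: poisson_pow_bound.
Qed.

Let derN r : `|r| < 1 ->
  is_derive r 1 N (S (fun t => (n%:R - 2) * (t - r) * poisson_pow s r t)).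
Proof.
move=> r1; have [q rq q1] := mid r1.
have inq y : y \in `](- q), q[ -> `|y| < q by rewrite in_itv/= -ltr_norml.
have inq1 y : y \in `](- q), q[ -> `|y| < 1 by move=> /inq /lt_trans; apply.
apply: (@is_derive_sphere_Rint _ _
  (fun y v => poisson_pow (s - 1) y (v ord0 i))
  (fun y v => (n%:R - 2) * (v ord0 i - y) * poisson_pow s y (v ord0 i))
  (- q) q r ((n%:R + 2) * (1 + 1) * ((1 - q) ^+ 2) `^ (- s))).
- by rewrite in_itv/= -ltr_norml.
- by move=> y yq; apply: sphere_fun_poisson_pow => //; exact: inq1.
- move=> y v yq v1; have y1 := inq1 y yq; have t1 := le1 v1.
  apply: is_derive_eq (is_derive_poisson_pow_r (s - 1) y1 t1) _.
  rewrite subrK; congr (_ * _ * _); rewrite mulrBr mulr1; congr (_ - _).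
  by rewrite mulrC divfK.
- move=> y v yq v1; have y1 := inq1 y yq; have t1 := le1 v1.
  have yq' := ltW (inq _ yq).
  rewrite !normrM ler_pM ?mulr_ge0//; last exact: poisson_pow_bound.
  apply: ler_pM => //; apply: (le_trans (ler_normB _ _)).
    by rewrite !ger0_norm.
  by apply: lerD => //; exact: ltW.
Qed.

Let poisson_pow0 p t : poisson_pow p 0 t = 1.
Proof. by rewrite /poisson_pow mulr0 mul0r subr0 expr0n/= addr0 powR1. Qed.

Let MW r : 0 <= r -> r < 1 -> M r = W.
Proof.
move=> r0 r1; have M0 : M 0 = W.
  by apply: eq_sphere_Rint => v _; rewrite poisson_pow0 mul0r subr0 mulr1.
have [->//|rn0] := eqVneq r 0.
rewrite -M0; apply: (derive0_eq_at0 (f' := fun=> 0)) => //.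
by rewrite lt_neqAle eq_sym rn0.
Qed.

(** Given [M = W], the power [x^(n-2)] is an integrating factor for the equation satisfied by [N].
    The constant is 0 because [N 0 = W], which also covers [n = 2], where the factor is 1; dividing
    by [r^(n-2)] concludes. *)
Let NW r : 0 <= r -> r < 1 -> N r = W.
Proof.
move=> r0 r1; have N0 : N 0 = W by apply: eq_sphere_Rint => v _; rewrite poisson_pow0.
have [->//|rn0] := eqVneq r 0.
have rgt0 : 0 < r by rewrite lt_neqAle eq_sym rn0.
pose k := n.-2; pose N' x := S (fun t => (n%:R - 2) * (t - x) * poisson_pow s x t).
pose G x := x ^+ k * (N x - W).
have dG (x : R) : `|x| < 1 -> is_derive x 1 G (x ^+ k * N' x + k%:R * x ^+ k.-1 * (N x - W)).
  move=> x1; have d1 := derN x1.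
  have d2 : is_derive x 1 (fun x : R => x ^+ k) (k%:R * x ^+ k.-1).
    apply: DeriveDef; first exact: exprn_derivable.
    by rewrite exp_derive [LHS]mulr1.
  have d3 : is_derive x 1 (fun x => N x - W) (N' x).
    by apply: is_derive_eq; rewrite subr0.
  apply: is_derive_eq; rewrite /GRing.scale/=; ring.
have : G r = G 0.
  apply: (derive0_eq_at0 rgt0 r1 dG) => x x0 x1.
  have x1' : `|x| < 1 by rewrite gtr0_norm.
  (* Multiplying by [x > 0] turns [x ^+ k.-1] back into [x ^+ k]. The truncated predecessor at
     [k = 0] is harmless, its coefficient being 0; [E] treats both cases. *)
  apply/eqP; rewrite -(mulrI_eq0 _ (lregP (lt0r_neq0 x0))); apply/eqP.
  have E (m : nat) (a b : R) : x * (x ^+ m * a + m%:R * x ^+ m.-1 * b) =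
      x ^+ m * (x * a + m%:R * b).
    by case: m => [|m] /=; rewrite ?exprS; ring.
  rewrite E.
  (* With [W] read as [M x], this is the pointwise identity [x (t - x) = (1 - x t) - D], multiplied
     by [(n - 2) D^(-s)]. *)
  suff -> : x * N' x = k%:R * (W - N x) by rewrite -mulrDr addrA subrK subrr !mulr0.
  rewrite -(MW (ltW x0) x1) /N' /M /N.
  have sfM : sphere_fun (fun v : 'rV[R]_n => (1 - x * v ord0 i) * poisson_pow s x (v ord0 i)).
    have := sphere_fun_lin 1 (- x) s0 x1'.
    by under eq_fun do rewrite mulNr.
  have sfN := sphere_fun_poisson_pow i s1 x1'.
  rewrite -sphere_RintB// -!sphere_RintZ//; last exact: sphere_funB.
    apply: eq_sphere_Rint => v v1; rewrite (poisson_powS (s - 1) x1' (le1 v1)) subrK.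
    have -> : k%:R = n%:R - 2 :> R by rewrite /k -subn2 natrB.
    by ring.
  under eq_fun do rewrite -mulrA.
  apply: sphere_funZ; have := sphere_fun_lin (- x) 1 s0 x1'.
  by under eq_fun do rewrite mul1r addrC.
rewrite /G N0 subrr mulr0 => /eqP; rewrite mulf_eq0 expf_eq0 (negbTE rn0) andbF/=.
by rewrite subr_eq0 => /eqP.
Qed.

(** Rests on the pointwise identity [1 - r^2 = 2 (1 - r t) - D]. *)
Lemma sphere_Rint_poisson r : 0 <= r -> r < 1 ->
  (1 - r ^+ 2) * S (poisson_pow s r) = W.
Proof.
move=> r0 r1; have r1' : `|r| < 1 by rewrite ger0_norm.
have sfM : sphere_fun (fun v : 'rV[R]_n => (1 - r * v ord0 i) * poisson_pow s r (v ord0 i)).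
  have := sphere_fun_lin 1 (- r) s0 r1'.
  by under eq_fun do rewrite mulNr.
have sfN := sphere_fun_poisson_pow i s1 r1'.
have -> : W = 2 * M r - N r by rewrite MW// NW//; ring.
rewrite /M /N -!sphere_RintZ//; last exact: sphere_fun_poisson_pow.
rewrite -sphere_RintB//; last exact: sphere_funZ.
apply: eq_sphere_Rint => v v1; rewrite (poisson_powS (s - 1) r1' (le1 v1)) subrK.
by ring.
Qed.

(** From [r t = 1 - (1 - r t)], [r] times the integral is the previous one minus [M r = W].
    Cancelling [r] sets [r = 0] apart, where the integrand is a mere coordinate. *)
Lemma sphere_Rint_poisson_coord r : 0 <= r -> r < 1 ->
  (1 - r ^+ 2) * S (fun t => t * poisson_pow s r t) = r * W.
Proof.
move=> r0 r1; have r1' : `|r| < 1 by rewrite ger0_norm.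
have [->|rn0] := eqVneq r 0.
  rewrite mul0r (eq_sphere_Rint (g := fun v => v ord0 i)) ?sphere_Rint_coord ?mulr0//.
  by move=> v _; rewrite poisson_pow0 mulr1.
have sfZ := sphere_fun_poisson_pow i s0 r1'.
have sfT : sphere_fun (fun v : 'rV[R]_n => v ord0 i * poisson_pow s r (v ord0 i)).
  by apply: sphere_funM => //; exact: sphere_fun_coord.
have E : S (poisson_pow s r) - r * S (fun t => t * poisson_pow s r t) = W.
  rewrite -[RHS](MW r0 r1) -sphere_RintZ// -sphere_RintB//; last exact: sphere_funZ.
  by apply: eq_sphere_Rint => v _; ring.
have F := sphere_Rint_poisson r0 r1.
apply: (mulfI rn0); rewrite mulrCA.
move: E F; set Z := sphere_Rint _; set T := sphere_Rint _ => E F.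
have -> : r * T = Z - W by rewrite -E; ring.
by rewrite mulrBr F; ring.
Qed.

End zonal.
End poisson_kernel.

(** * The area of the sphere *)

Section gamma_recursion.
Context {R : realType}.
Local Notation leb := (@lebesgue_measure R).
Local Open Scope ereal_scope.

(** The integral inside [Gamma] before [fine] is applied. In the extended reals the recursion holds
    without knowing that the integral converges. *)
Definition egamma (a : R) : \bar R :=
  \int[leb]_(t in `[0%R, +oo[) (t `^ (a - 1) * expR (- t))%:E.

Lemma integral_expRN (y : R) :
  \int[leb]_(t in `[y, +oo[) (expR (- t))%:E = (expR (- y))%:E.
Proof.
have dF (x : R) : is_derive x (1%R : R) (fun t : R => - expR (- t))%R (expR (- x)).
  by apply: is_derive_eq; rewrite /GRing.scale/= mulrN1 opprK.
rewrite (@ge0_continuous_FTC2y _ (fun t => expR (- t)) (fun t => - expR (- t))%R y 0%R).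
- by rewrite EFinN oppeK add0e.
- by move=> x _; exact: expR_ge0.
- apply: derivable_within_continuous => x _.
  by apply: ex_derive.
- rewrite -oppr0; apply: cvgN.
  have := @cvgr_expR R; by [].
- by move=> x _; have [] := dF x.
- apply: cvg_at_right_filter.
  have cF : {for y, continuous (fun t : R => - expR (- t))%R}.
    apply: (@differentiable_continuous _ R^o R^o); apply/derivable1_diffP.
    by have [] := dF y.
  exact: cF.
- by move=> x _; rewrite derive1E; have [_ ->] := dF x.
Qed.

Lemma continuous_powR_pos (b x : R) : (0 < x)%R -> {for x, continuous (@powR R ^~ b)}.
Proof.
move=> x0; apply: (@differentiable_continuous _ R^o R^o); apply/derivable1_diffP.
by apply: derivable_powR; rewrite in_itv/= x0.
Qed.

Lemma integral_powR (a t : R) : (1 <= a)%R -> (0 <= t)%R ->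
  \int[leb]_(u in `[0%R, t]) (a * u `^ (a - 1))%:E = (t `^ a)%:E.
Proof.
move=> a1 t0; have a0 : (0 < a)%R by exact: lt_le_trans a1.
have [->|tn0] := eqVneq t 0%R.
  by rewrite set_itv1 integral_set1 powR0 ?gt_eqF.
have {tn0}t0 : (0 < t)%R by rewrite lt_neqAle eq_sym tn0.
rewrite (@continuous_FTC2 _ (fun u => a * u `^ (a - 1))%R (fun u => u `^ a)%R 0%R t)//.
- by rewrite powR0 ?gt_eqF// sube0.
(* At [a = 1] the integrand is the constant 1, including at 0; for [a > 1] it tends to its value 0
   there. The continuity arguments differ. *)
- have [->|an1] := eqVneq a 1%R.
    rewrite (_ : (fun u : R => 1 * u `^ (1 - 1))%R = cst 1%R); last first.
      by apply/funext => u; rewrite subrr powRr0 mulr1.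
    by move=> x; exact: cvg_cst.
  have a10 : (0 < a - 1)%R by rewrite subr_gt0 lt_neqAle eq_sym an1.
  apply/continuous_within_itvP => //; split.
  + move=> x; rewrite in_itv/= => /andP[x0 _].
    apply: cvgM; first exact: cvg_cst.
    exact: continuous_powR_pos.
  + rewrite powR0 ?gt_eqF//; apply: cvgM; first exact: cvg_cst.
    exact: powR_cvg0.
  + apply: cvgM; first exact: cvg_cst.
    by apply: cvg_at_left_filter; exact: continuous_powR_pos.
- split.
  + by move=> x; rewrite in_itv/= => /andP[x0 _]; apply: derivable_powR; rewrite in_itv/= x0.
  + by rewrite powR0 ?gt_eqF//; exact: powR_cvg0.
  + by apply: cvg_at_left_filter; exact: continuous_powR_pos.
- move=> x; rewrite in_itv/= => /andP[x0 _]; rewrite powR_derive1//.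
  by rewrite in_itv/= x0.
Qed.

(* Both sides are the integral of [a u^(a-1) e^(-t)] over [0 <= u <= t]. *)
Lemma egammaS (a : R) : (1 <= a)%R -> egamma (a + 1) = a%:E * egamma a.
Proof.
move=> a1; have a0 : (0 < a)%R by exact: lt_le_trans a1.
pose A : set (measurableTypeR R * measurableTypeR R) :=
  [set p | (0 <= p.1)%R && (p.1 <= p.2)%R].
have mA : measurable A.
  have mb : measurable_fun setT (fun p : measurableTypeR R * measurableTypeR R =>
      (0 <= p.1)%R && (p.1 <= p.2)%R).
    by apply: measurable_and; exact: measurable_fun_ler.
  by have := mb measurableT [set true] I; rewrite setTI.
pose F (p : measurableTypeR R * measurableTypeR R) : \bar R :=
  (\1_A p * (a * p.1 `^ (a - 1) * expR (- p.2)))%:E.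
have mpow (b : R) : measurable_fun setT (fun u : R => u `^ b)%R by exact: measurable_powR.
have mexp : measurable_fun setT (fun u : R => expR (- u)).
  by apply: measurableT_comp => //; exact: measurable_oppr.
have mF : measurable_fun setT F.
  apply/measurable_EFinP; apply: measurable_funM; first exact: measurable_indic.
  apply: measurable_funM; last exact: (measurableT_comp mexp measurable_snd).
  by apply: measurable_funM => //; exact: (measurableT_comp (mpow _) measurable_fst).
have F0 p : 0 <= F p.
  by rewrite lee_fin !mulr_ge0// ?powR_ge0 ?expR_ge0// ltW.
have := @fubini_tonelli _ _ (measurableTypeR R) (measurableTypeR R) R leb leb F mF F0.
have -> : \int[leb]_x \int[leb]_y F (x, y) = a%:E * egamma a.
  rewrite /egamma -ge0_integralZl//; last 3 first.
  - apply/measurable_EFinP; apply: measurable_funTS.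
    by apply: measurable_funM => //; exact: mpow.
  - by move=> t _; rewrite lee_fin mulr_ge0 ?powR_ge0 ?expR_ge0.
  - by rewrite lee_fin ltW.
  rewrite [RHS]integral_mkcond; apply: eq_integral => u _; rewrite patchE.
  case: ifPn => [|u0].
    rewrite inE/= in_itv/= andbT => u0.
    rewrite -EFinM mulrA EFinM -integral_expRN -ge0_integralZl//; last 2 first.
    - by apply/measurable_EFinP; apply: measurable_funTS.
    - by rewrite lee_fin mulr_ge0 ?powR_ge0// ltW.
    rewrite [RHS]integral_mkcond; apply: eq_integral => t _; rewrite patchE /F indicE.
    rewrite (_ : ((u, t) \in A) = (t \in `[u, +oo[%classic)); last first.
      by apply/idP/idP; rewrite !inE /A/= in_itv/= u0 andbT.
    by case: ifPn => _; rewrite ?mul1r ?mul0r// EFinM.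
  rewrite integral0_eq// => t _; rewrite /F indicE memNset ?mul0r// /A/=.
  by move: u0; rewrite notin_setE/= in_itv/= andbT => /negP/negbTE ->.
have -> : \int[leb]_y \int[leb]_x F (x, y) = egamma (a + 1).
  rewrite /egamma [RHS]integral_mkcond; apply: eq_integral => t _; rewrite patchE.
  case: ifPn => [|t0].
    rewrite inE/= in_itv/= andbT => t0.
    rewrite addrK EFinM -integral_powR//.
    rewrite -ge0_integralZr//; last 2 first.
    - apply/measurable_EFinP; apply: measurable_funTS.
      by apply: measurable_funM => //; exact: mpow.
    - by move=> u _; rewrite lee_fin mulr_ge0 ?powR_ge0// ltW.
    rewrite [RHS]integral_mkcond; apply: eq_integral => u _; rewrite patchE /F indicE.
    rewrite (_ : ((u, t) \in A) = (u \in `[0%R, t]%classic)); last first.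
      by apply/idP/idP; rewrite !inE /A/= ?in_itv.
    by case: ifPn => _; rewrite ?mul1r ?mul0r// EFinM.
  rewrite integral0_eq// => u _; rewrite /F indicE memNset ?mul0r// /A/=.
  move: t0; rewrite notin_setE/= in_itv/= andbT => /negP t0 /andP[u0 ut].
  by rewrite (le_trans u0 ut) in t0.
by [].
Qed.

End gamma_recursion.

(** * Volume of the ball and total mass of the sphere *)

Section sphere_area.
Context {R : realType}.
Local Notation leb := (@lebesgue_measure R).
Local Notation mu := (@tuple_lebesgue R).
Implicit Types n : nat.
Local Open Scope ereal_scope.

(** Indexed by the squared radius, the variable of the layer cake formula for [expR (- |x|^2)]. *)
Definition pball2 n (s : R) : set (n.-tuple R) :=
  [set t | (0 < enorm (rv_of_tuple t))%R && (enorm (rv_of_tuple t) ^+ 2 <= s)%R].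

Lemma pball2_1 n : @pball2 n 1 = @pball R n.
Proof.
by apply/funext => t; rewrite /pball2 /pball /mkset expr_le1// enorm_ge0.
Qed.

(** The balls are punctured while the Gaussian integral runs over the whole space. The indicator of
    the origin is a product of one-dimensional indicators, of integral [0 ^+ n]. *)
Lemma ae_enorm_gt0 n : (0 < n)%N ->
  {ae mu n, forall t, (0 < enorm (rv_of_tuple t))%R}.
Proof.
move=> n0.
pose g (t : n.-tuple R) : R := (\prod_(i < n) \1_([set 0%R] : set R) (tnth t i))%R.
have m1 : measurable_fun setT (\1_([set 0%R] : set R) : R -> R) by exact: measurable_indic.
have mg : measurable_fun setT g by exact: measurable_fun_prod_tnth.
have ig : \int[mu n]_t (g t)%:E = 0.
  rewrite (@integral_prod_tnth _ n _ 0%R)//; first by rewrite expr0n gtn_eqF.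
  by rewrite integral_indic// setIT; exact: lebesgue_measure_set1.
have : \int[mu n]_t `|(EFin \o g) t| = 0.
  rewrite -[RHS]ig; apply: eq_integral => t _ /=; rewrite ger0_norm//.
  by apply: prodr_ge0 => i _; rewrite indicE.
move=> /(iffLR (ae_eq_integral_abs _ measurableT (iffRL (measurable_EFinP _ _) mg))).
apply: filterS => t /(_ I) /= [] /eqP g0.
rewrite lt_neqAle enorm_ge0 andbT; apply/negP => /eqP t0.
move: g0; apply/negP; rewrite /g big1 ?oner_eq0// => i _.
rewrite indicE mem_set//=; have := le_coord_enorm (rv_of_tuple t) i.
by rewrite -t0 normr_le0 mxE => /eqP.
Qed.

Let A n : set (n.-tuple R * measurableTypeR R) :=
  [set p | (0 < enorm (rv_of_tuple p.1))%R && (enorm (rv_of_tuple p.1) ^+ 2 <= p.2)%R].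

Let mA n : measurable (@A n).
Proof.
have mn := @measurable_enorm R n.
have mb : measurable_fun setT (fun p : n.-tuple R * measurableTypeR R =>
    (0 < enorm (rv_of_tuple p.1))%R && (enorm (rv_of_tuple p.1) ^+ 2 <= p.2)%R).
  apply: measurable_and.
    by apply: measurable_fun_ltr => //; exact: (measurableT_comp mn measurable_fst).
  apply: measurable_fun_ler => //; apply: measurable_funX.
  exact: (measurableT_comp mn measurable_fst).
by have := mb measurableT [set true] I; rewrite setTI.
Qed.

Lemma measurable_pball2 n s : measurable (@pball2 n s).
Proof.
have mn := @measurable_enorm R n.
have mb : measurable_fun setT (fun t : n.-tuple R =>
    (0 < enorm (rv_of_tuple t))%R && (enorm (rv_of_tuple t) ^+ 2 <= s)%R).
  apply: measurable_and; first exact: measurable_fun_ltr.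
  by apply: measurable_fun_ler => //; exact: measurable_funX.
by have := mb measurableT [set true] I; rewrite setTI.
Qed.

Lemma measure_pball2 n (s : R) : (0 < n)%N -> (0 <= s)%R ->
  mu n (@pball2 n s) = (s `^ (n%:R / 2))%:E * mu n (@pball R n).
Proof.
move=> n0 s0; have [->|sn0] := eqVneq s 0%R.
  rewrite powR0; last by rewrite mulf_neq0 ?invr_eq0 ?pnatr_eq0 -?lt0n.
  rewrite mul0e (_ : pball2 _ = set0) ?measure0//.
  apply/seteqP; split => // t /andP[t0 t1].
  by have := lt_le_trans (exprn_gt0 2 t0) t1; rewrite ltxx.
have sgt0 : (0 < s)%R by rewrite lt_neqAle eq_sym sn0.
have c0 : (0 < Num.sqrt s)%R by rewrite sqrtr_gt0.
have mE u : mu n (@pball2 n u) = \int[mu n]_t (\1_(@pball2 n u) t)%:E.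
  by rewrite integral_indic ?setIT//; exact: measurable_pball2.
rewrite -pball2_1 !mE.
rewrite (ge0_integral_tuple_scale c0); last 2 first.
- by apply/measurable_EFinP; apply: measurable_indic; exact: measurable_pball2.
- by move=> t; rewrite lee_fin indicE.
congr (_%:E * _).
  by rewrite mulrC powRrM powR12_sqrt// powR_mulrn ?sqrtr_ge0.
apply: eq_integral => t _; rewrite !indicE; congr (_%:R%:E)%R; congr nat_of_bool.
apply/idP/idP; rewrite !inE /pball2/= rv_of_tuple_scale enormZ (gtr0_norm c0) pmulr_rgt0//
  exprMn (sqr_sqrtr s0) => /andP[-> /=]; by rewrite -{2}[s]mulr1 ler_pM2l.
Qed.

(* Layer cake: [expR (- |x|^2)] is the integral of [expR (- s)] over [s >= |x|^2]. *)
Lemma gauss_pball n : (0 < n)%N ->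
  (Num.sqrt pi ^+ n)%:E = mu n (@pball R n) * egamma (n%:R / 2 + 1).
Proof.
move=> n0.
pose F (p : n.-tuple R * measurableTypeR R) : \bar R := (\1_(@A n) p * expR (- p.2))%:E.
have mexp : measurable_fun setT (fun u : R => expR (- u)).
  by apply: measurableT_comp => //; exact: measurable_oppr.
have mF : measurable_fun setT F.
  apply/measurable_EFinP; apply: measurable_funM; first by apply: measurable_indic; exact: mA.
  exact: (measurableT_comp mexp measurable_snd).
have F0 p : 0 <= F p by rewrite lee_fin mulr_ge0 ?expR_ge0.
have := @fubini_tonelli _ _ (n.-tuple R) (measurableTypeR R) R (mu n) leb F mF F0.
have -> : \int[mu n]_x \int[leb]_y F (x, y) = (Num.sqrt pi ^+ n)%:E.
  rewrite -integral_tuple_gauss; apply: ae_eq_integral => //.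
  - exact: (@measurable_fun_fubini_tonelli_F _ _ (n.-tuple R) (measurableTypeR R) R leb F mF F0).
  - by apply/measurable_EFinP; apply: measurable_fun_prod_tnth; exact: measurable_gauss_fun.
  apply: filterS (ae_enorm_gt0 n0) => t t0 _.
  rewrite tuple_gaussE.
  have -> : (\sum_(i < n) tnth t i ^+ 2 = enorm (rv_of_tuple t) ^+ 2)%R.
    by rewrite sqr_enorm dotE; apply: eq_bigr => i _; rewrite mxE expr2.
  rewrite -integral_expRN [RHS]integral_mkcond; apply: eq_integral => s _.
  rewrite patchE /F indicE.
  rewrite (_ : ((t, s) \in @A n) = (s \in `[(enorm (rv_of_tuple t) ^+ 2)%R, +oo[%classic)).
    by case: ifPn => _; rewrite ?mul1r ?mul0r.
  by apply/idP/idP; rewrite !inE /A/= in_itv/= t0 andbT.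
move=> ->.
have V0 : 0 <= mu n (@pball R n) by exact: measure_ge0.
have mpow (b : R) : measurable_fun setT (fun u : R => u `^ b)%R by exact: measurable_powR.
rewrite /egamma -ge0_integralZl//; last 2 first.
- apply/measurable_EFinP; apply: measurable_funTS.
  by apply: measurable_funM; [exact: (mpow (n%:R / 2 + 1 - 1)%R)|exact: mexp].
- by move=> s _; rewrite lee_fin mulr_ge0 ?powR_ge0 ?expR_ge0.
rewrite [RHS]integral_mkcond; apply: eq_integral => s _; rewrite patchE.
have E : \int[mu n]_x F (x, s) = (expR (- s))%:E * mu n (@pball2 n s).
  rewrite -[X in _ * mu n X]setIT -integral_indic//; last exact: measurable_pball2.
  rewrite -ge0_integralZl//.
  - by apply: eq_integral => t _; rewrite /F EFinM muleC.
  - by apply/measurable_EFinP; apply: measurable_indic; exact: measurable_pball2.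
rewrite E; case: ifPn => [|s0].
  rewrite inE/= in_itv/= andbT => s0.
  by rewrite measure_pball2// addrK muleA -EFinM muleC [(expR _ * _)%R]mulrC.
(* For [s < 0] the ball is empty, in agreement with a Gamma integral over [[0, +oo[]. *)
rewrite (_ : pball2 _ = set0) ?measure0 ?mule0//.
move: s0; rewrite notin_setE/= in_itv/= andbT => /negP; rewrite -ltNge => s0.
apply/seteqP; split => // t /andP[t0 t1].
by have := lt_trans (lt_le_trans (exprn_gt0 2 t0) t1) s0; rewrite ltxx.
Qed.

Lemma pball_fin_num n : mu n (@pball R n) \is a fin_num.
Proof.
have mp := @measurable_pball R n.
have := integrable_fin_num mp (integrable_sphere_fun (sphere_fun_cst n 1%R)).
by rewrite /comp/= integral_cst ?mul1e.
Qed.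

Lemma sphere_mass_pball n :
  @sphere_mass R n = (n%:R * fine (mu n (@pball R n)))%R.
Proof.
rewrite /sphere_mass /sphere_Rint Rintegral_cst ?mul1r//.
exact: measurable_pball.
Qed.

(** With V the volume of the ball, the layer cake identity and one step of the recursion give
    [pi^(n/2) = V (n/2) Gamma(n/2)], and the mass is [n V]. The recursion is applied at [n/2 >= 1],
    which is what [2 <= n] provides. *)
Lemma sphere_massE n : (2 <= n)%N -> sphere_mass n = sphere_area n :> R.
Proof.
move=> n2; have n0 : (0 < n)%N by exact: ltnW.
have n2R : (2 <= n%:R :> R)%R by rewrite ler_nat.
have E := gauss_pball n0.
rewrite egammaS in E; last by rewrite ler_pdivlMr// mul1r.
have pn : (0 < Num.sqrt pi ^+ n :> R)%R by rewrite exprn_gt0// sqrtr_gt0 pi_gt0.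
have V := pball_fin_num n.
have G0 : 0 <= egamma (n%:R / 2 : R).
  by apply: integral_ge0 => t _; rewrite lee_fin mulr_ge0 ?powR_ge0 ?expR_ge0.
rewrite sphere_mass_pball.
rewrite /sphere_area /Gamma -/(egamma _).
move: E V G0; case: (mu n (@pball R n)) => // v; case: (egamma _) => [g| |]//=.
- rewrite -!EFinM => -[E] _ g0.
  have -> : ((pi : R) `^ (n%:R / 2) = Num.sqrt pi ^+ n)%R.
    by rewrite (mulrC n%:R) powRrM powR12_sqrt ?pi_ge0// powR_mulrn ?sqrtr_ge0.
  rewrite E.
  have gn0 : g != 0%R.
    by apply/eqP => g00; move: pn; rewrite E g00 !mulr0 ltxx.
  by field.
(* An infinite Gamma integral would make the right-hand side infinite, or 0 if V is 0, against a
   finite positive left-hand side. *)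
- move=> E _ _; exfalso; move: E.
  rewrite gt0_muley ?lte_fin ?divr_gt0 ?ltr0n//.
  have [v0|v0|->] := ltgtP v 0%R.
  + by rewrite lt0_muley.
  + by rewrite gt0_muley.
  + by rewrite mul0e => -[] /eqP; rewrite gt_eqF.
Qed.

Lemma sphere_mass_neq0 n : (0 < n)%N -> (@sphere_mass R n != 0)%R.
Proof.
move=> n0; have E := gauss_pball n0.
have pn : (0 < Num.sqrt pi ^+ n :> R)%R by rewrite exprn_gt0// sqrtr_gt0 pi_gt0.
have V := pball_fin_num n.
rewrite sphere_mass_pball.
rewrite mulf_neq0 ?pnatr_eq0 -?lt0n//.
move: E V; case: (mu n (@pball R n)) => // v E _ /=.
by apply/eqP => v0; move: E pn; rewrite v0 mul0e => -[->]; rewrite ltxx.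
Qed.

End sphere_area.

(** * The Johnson-Wehrly distribution *)

Section johnson_wehrly.
Context {R : realType}.
Variables (n : nat) (rho : R) (Q : 'M[R]_n).
Hypotheses (n2 : (2 <= n)%N) (rho0 : 0 <= rho) (rho1 : rho < 1)
  (QQ : Q *m Q^T = 1%:M).
Local Notation c := (jw_density rho Q).
Local Notation W := (@sphere_mass R n).
Local Notation s := (n%:R / 2 : R).

Let n0 : (0 < n)%N. Proof. exact: ltnW. Qed.
Let i0 : 'I_n := Ordinal n0.
Let W0 : W != 0. Proof. exact: sphere_mass_neq0. Qed.
Let s0 : 0 <= s. Proof. by rewrite divr_ge0. Qed.
Let nrho1 : `|rho| < 1. Proof. by rewrite ger0_norm. Qed.
Let rho2 : 1 - rho ^+ 2 != 0.
Proof. by rewrite subr_eq0 eq_sym lt_eqF// exprn_ilt1. Qed.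
Let k : R := (W ^+ 2)^-1 * (1 - rho ^+ 2).
Let f := poisson_pow s rho.
Let B : R := ((1 - `|rho|) ^+ 2) `^ (- s).
Let mf : measurable_fun setT f. Proof. exact: measurable_poisson_pow. Qed.
Let fB t : `|t| <= 1 -> `|f t| <= B.
Proof. by move=> t1; exact: poisson_pow_bound. Qed.

Let cE u v : c u v = k * f (dot (u *m Q) v).
Proof.
rewrite /jw_density /k /f /poisson_pow powRN sphere_massE//.
Qed.

(** Exhibits the density as a zonal function of [u] for fixed [v], so that [u] can be integrated out
    first. *)
Let cET u v : c u v = k * f (dot (v *m Q^T) u).
Proof.
rewrite cE; congr (_ * f _).
by rewrite [RHS]dotC /dot trmx_mul trmxK mulmxA.
Qed.

Let QTQ : Q^T *m Q^T^T = 1%:M. Proof. by rewrite trmxK; exact: mulmx1C. Qed.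

Let zonal_fun (w : 'rV[R]_n) : enorm w = 1 -> sphere_fun (fun v => f (dot w v)).
Proof.
move=> w1; apply: (sphere_fun_comp mf (sphere_fun_dot w) (C := B)) => v v1.
by apply: fB; exact: dot_sphere_le1.
Qed.

(** Both marginals are uniform, with density [W^-1]: take [w = u Q] for [U] and [w = v Q^T] for
    [V]. *)
Let zonal_Rint (w : 'rV[R]_n) : enorm w = 1 ->
  k * sphere_Rint (fun v => f (dot w v)) = W^-1.
Proof.
move=> w1; rewrite (sphere_Rint_zonal i0 w1 mf fB).
rewrite /k -mulrA (sphere_Rint_poisson i0 n2 rho0 rho1).
by rewrite expr2 invfM -mulrA mulVf// mulr1.
Qed.

(** Divided by the marginal density [W^-1], with [w = u Q], this says that the conditional mean of
    [V] given [U = u] is [rho u Q]. *)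
Let zonal_Rint_coord (w : 'rV[R]_n) j : enorm w = 1 ->
  k * sphere_Rint (fun v => v ord0 j * f (dot w v)) = rho * W^-1 * w ord0 j.
Proof.
move=> w1; rewrite (sphere_Rint_zonal_coord i0 j w1 mf fB).
have := sphere_Rint_poisson_coord i0 n2 rho0 rho1; rewrite -/f.
set T := sphere_Rint _ => E.
rewrite /k; transitivity ((W ^+ 2)^-1 * w ord0 j * ((1 - rho ^+ 2) * T)); first by ring.
by rewrite E; field.
Qed.

Let sphere_funG (g : 'rV[R]_n -> R) (u : 'rV[R]_n) : sphere_fun g -> enorm u = 1 ->
  sphere_fun (fun v => g v * c u v).
Proof.
move=> sg u1; apply: sphere_funM => //.
apply: (eq_sphere_fun (f := fun v => k * f (dot (u *m Q) v))) => [v _|].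
  by rewrite cE.
by apply: sphere_funZ; apply: zonal_fun; rewrite enorm_mulmx.
Qed.

Let expect_densE (h : 'rV[R]_n -> 'rV[R]_n -> R) (H : 'rV[R]_n -> R) :
  (forall u, enorm u = 1 -> sphere_fun (h u)) ->
  (forall u, enorm u = 1 -> sphere_Rint (fun v => h u v * c u v) = H u) ->
  sphere_fun H -> expect_dens c h = (sphere_Rint H)%:E.
Proof.
move=> sh hH sH; rewrite -sphere_intE//; apply: eq_sphere_int => u u1.
by rewrite sphere_intE ?hH//; apply: sphere_funG => //; exact: sh.
Qed.

Let Rint_c (a : R) (u : 'rV[R]_n) : enorm u = 1 ->
  sphere_Rint (fun v => a * c u v) = W^-1 * a.
Proof.
move=> u1; have w1 : enorm (u *m Q) = 1 by rewrite enorm_mulmx.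
transitivity (sphere_Rint (fun v => a * k * f (dot (u *m Q) v))).
  by apply: eq_sphere_Rint => v _; rewrite cE mulrA.
by rewrite sphere_RintZ; [rewrite -mulrA zonal_Rint// mulrC|exact: zonal_fun].
Qed.

Let Rint_coord_c (a : R) j (u : 'rV[R]_n) : enorm u = 1 ->
  sphere_Rint (fun v => a * v ord0 j * c u v) = rho * W^-1 * (a * (u *m Q) ord0 j).
Proof.
move=> u1; have w1 : enorm (u *m Q) = 1 by rewrite enorm_mulmx.
transitivity (sphere_Rint (fun v => a * k * (v ord0 j * f (dot (u *m Q) v)))).
  by apply: eq_sphere_Rint => v _; rewrite cE; ring.
rewrite sphere_RintZ; first by rewrite -mulrA zonal_Rint_coord//; ring.
by apply: sphere_funM; [exact: sphere_fun_coord|exact: zonal_fun].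
Qed.

Lemma expect_U i : expect_dens c (fun u _ => u 0 i) = 0%E.
Proof.
rewrite (@expect_densE _ (fun u => W^-1 * u ord0 i)).
- by rewrite sphere_RintZ ?sphere_Rint_coord ?mulr0//; exact: sphere_fun_coord.
- by move=> u u1; exact: sphere_fun_cst.
- by move=> u u1; rewrite Rint_c.
- by apply: sphere_funZ; exact: sphere_fun_coord.
Qed.

Lemma expect_V i : expect_dens c (fun _ v => v 0 i) = 0%E.
Proof.
have sQ := sphere_fun_mulmx QQ (@sphere_fun_coord R n i).
rewrite (@expect_densE _ (fun u => rho * W^-1 * (u *m Q) ord0 i)).
- rewrite sphere_RintZ// (sphere_Rint_mulmx QQ (@sphere_fun_coord R n i)).
  by rewrite sphere_Rint_coord mulr0.
- by move=> u u1; exact: sphere_fun_coord.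
- move=> u u1; have := Rint_coord_c 1 i u1; rewrite mul1r => <-.
  by apply: eq_sphere_Rint => v _; rewrite mul1r.
- exact: sphere_funZ.
Qed.

Let sphere_fun_coordM i j : sphere_fun (fun v : 'rV[R]_n => v ord0 i * v ord0 j).
Proof. by apply: sphere_funM; exact: sphere_fun_coord. Qed.

Lemma expect_UU i j : expect_dens c (fun u _ => u 0 i * u 0 j) =
  (n%:R^-1 * (1%:M : 'M[R]_n) i j)%:E.
Proof.
rewrite (@expect_densE _ (fun u => W^-1 * (u ord0 i * u ord0 j))).
- by rewrite sphere_RintZ// sphere_Rint_coordM// mulrC mulfK// mxE.
- by move=> u u1; exact: sphere_fun_cst.
- by move=> u u1; rewrite Rint_c.
- exact: sphere_funZ.
Qed.

Let measurable_coord i : measurable_fun setT (fun t : n.-tuple R => direction t ord0 i).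
Proof.
apply: (@measurable_direction R n (fun v => v ord0 i)).
apply: eq_measurable_fun (@measurable_tnth _ _ _ i) => t _.
by rewrite /= mxE.
Qed.

Let sphere_fun2_VV i j : sphere_fun2 (fun u v => v ord0 i * v ord0 j * c u v).
Proof.
apply: (@sphere_fun2P _ _ _ (`|k| * B)) => [|u v u1 v1]; last first.
  rewrite cE normrM -[leRHS]mul1r ler_pM//.
    by rewrite normrM -[leRHS]mul1r ler_pM// -v1 le_coord_enorm.
  rewrite normrM ler_wpM2l// fB// dot_sphere_le1//.
  by rewrite enorm_mulmx.
have m2 l : measurable_fun setT (fun p : n.-tuple R * n.-tuple R => direction p.2 ord0 l).
  exact: (measurableT_comp (measurable_coord l) measurable_snd).
apply: measurable_funM; first exact: measurable_funM.
under eq_fun do rewrite cE dotE.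
apply: measurable_funM => //; apply: (measurableT_comp mf).
apply: measurable_sum => l; apply: measurable_funM => //.
under eq_fun do rewrite mxE.
apply: measurable_sum => m; apply: measurable_funM => //.
exact: (measurableT_comp (measurable_coord m) measurable_fst).
Qed.

(** In the given order the inner integral would be a second moment of the Poisson kernel. After
    exchanging the integrals, the inner one is only the uniform marginal of [V]. *)
Lemma expect_VV i j : expect_dens c (fun _ v => v 0 i * v 0 j) =
  (n%:R^-1 * (1%:M : 'M[R]_n) i j)%:E.
Proof.
have sF := sphere_fun2_VV i j.
rewrite (@expect_densE _ (fun u => sphere_Rint (fun v => v ord0 i * v ord0 j * c u v))).
- rewrite (sphere_Rint_swap sF).
  transitivity (sphere_Rint (fun v : 'rV[R]_n => W^-1 * (v ord0 i * v ord0 j)))%:E.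
    congr EFin; apply: eq_sphere_Rint => v v1.
    have w1 : enorm (v *m Q^T) = 1 by rewrite enorm_mulmx.
    transitivity (sphere_Rint (fun u => v ord0 i * v ord0 j * k * f (dot (v *m Q^T) u))).
      by apply: eq_sphere_Rint => u _; rewrite cET; ring.
    by rewrite sphere_RintZ; [rewrite -mulrA zonal_Rint// mulrC|exact: zonal_fun].
  by rewrite sphere_RintZ// sphere_Rint_coordM// mulrC mulfK// mxE.
- by move=> u u1; exact: sphere_fun_coordM.
- by [].
- exact: sphere_fun_Rint.
Qed.

(** Conditioning on [u] replaces [v_j] by [rho (u Q)_j]; in its expansion over [l], the uniform
    second moments keep only [l = i]. *)
Lemma expect_UV i j : expect_dens c (fun u v => u 0 i * v 0 j) =
  (n%:R^-1 * rho * Q i j)%:E.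
Proof.
have E (u : 'rV[R]_n) : u ord0 i * (u *m Q) ord0 j = \sum_l Q l j * (u ord0 i * u ord0 l).
  by rewrite mxE mulr_sumr; apply: eq_bigr => l _; ring.
rewrite (@expect_densE _ (fun u => rho * W^-1 * (u ord0 i * (u *m Q) ord0 j))).
- rewrite sphere_RintZ; last first.
    by under eq_fun do rewrite E; apply: sphere_fun_sum => l; exact: sphere_funZ.
  rewrite (eq_sphere_Rint (fun u _ => E u)) sphere_Rint_sum; last by move=> l; exact: sphere_funZ.
  rewrite (bigD1 i)//= big1 ?addr0 => [|l li]; rewrite sphere_RintZ// sphere_Rint_coordM//.
    have nn0 : n%:R != 0 :> R by rewrite pnatr_eq0 -lt0n.
    by rewrite eqxx mulr1; congr EFin; field; rewrite ?W0 ?nn0.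
  by rewrite eq_sym (negbTE li) mulr0 mul0r mulr0.
- by move=> u u1; apply: sphere_funZ; exact: sphere_fun_coord.
- by move=> u u1; exact: Rint_coord_c.
- by apply: sphere_funZ; under eq_fun do rewrite E; apply: sphere_fun_sum => l; exact: sphere_funZ.
Qed.

(** The factors [n^-1] cancel and [Q Q^T] is the identity, so the matrix is scalar and [rho ^+ 2] is
    its only eigenvalue. *)
Lemma jw_matrixE : jw_matrix c = (rho ^+ 2)%:M.
Proof.
have nn0 : n%:R != 0 :> R by rewrite pnatr_eq0 -lt0n.
have mU : mean_U c = 0 by apply/rowP => i; rewrite !mxE expect_U.
have mV : mean_V c = 0 by apply/rowP => i; rewrite !mxE expect_V.
have UU : Sigma_UU c = (n%:R^-1)%:M.
  rewrite /Sigma_UU mU mulmx0 subr0; apply/matrixP => i j.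
  by rewrite mxE expect_UU/= !mxE mulr_natr.
have VV : Sigma_VV c = (n%:R^-1)%:M.
  rewrite /Sigma_VV mV mulmx0 subr0; apply/matrixP => i j.
  by rewrite mxE expect_VV/= !mxE mulr_natr.
have UV : Sigma_UV c = (n%:R^-1 * rho) *: Q.
  rewrite /Sigma_UV mV mulmx0 subr0; apply/matrixP => i j.
  by rewrite mxE expect_UV/= mxE.
have trZ (a : R) : (a *: Q)^T = a *: Q^T by rewrite linearZ.
rewrite /jw_matrix UU VV UV invmx_scalar invrK trZ.
rewrite mul_scalar_mx mul_mx_scalar -!scalemxAl -scalemxAr !scalerA QQ.
rewrite scalemx1; congr (_%:M); by field.
Qed.

End johnson_wehrly.

Lemma eigenvalue_scalar_mx (R : realType) n (a m : R) : (0 < n)%N ->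
  eigenvalue (a%:M : 'M[R]_n) m = (m == a).
Proof.
move=> n0; apply/eigenvalueP/eqP => [[v]|->].
  rewrite mul_mx_scalar => /eqP; rewrite -subr_eq0 -scalerBl scaler_eq0 subr_eq0.
  by case/orP => [/eqP->//|/eqP->]; rewrite eqxx.
exists (unit_row (Ordinal n0)); first by rewrite mul_mx_scalar.
apply/eqP => /rowP /(_ (Ordinal n0)); rewrite !mxE !eqxx => /eqP.
by rewrite oner_eq0.
Qed.

Theorem theorem2 (R : realType) (d : nat) (rho : R) (Q : 'M[R]_d) :
  (2 <= d)%N -> 0 <= rho -> rho < 1 -> Q *m Q^T = 1%:M ->
  let c := jw_density rho Q in
  (* E(U) = E(V) = 0 *)
  (forall i, expect_dens c (fun u _ => u 0 i) = 0%E) /\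
  (forall i, expect_dens c (fun _ v => v 0 i) = 0%E) /\
  (* E(UU') = E(VV') = d^{-1} I *)
  (forall i j, expect_dens c (fun u _ => u 0 i * u 0 j)
               = ((d%:R)^-1 * (1%:M : 'M[R]_d) i j)%:E) /\
  (forall i j, expect_dens c (fun _ v => v 0 i * v 0 j)
               = ((d%:R)^-1 * (1%:M : 'M[R]_d) i j)%:E) /\
  (* E(UV') = d^{-1} rho Q *)
  (forall i j, expect_dens c (fun u v => u 0 i * v 0 j)
               = ((d%:R)^-1 * rho * Q i j)%:E) /\
  (* rho_JW = lambda^{1/2} = rho *)
  (exists l, largest_eigenvalue (jw_matrix c) l) /\
  (forall l, largest_eigenvalue (jw_matrix c) l -> Num.sqrt l = rho).
Proof.
move=> d2 rho0 rho1 QQ c.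
have eigE m : eigenvalue (jw_matrix c) m = (m == rho ^+ 2).
  by rewrite jw_matrixE// eigenvalue_scalar_mx// ltnW.
do !split.
- exact: expect_U.
- exact: expect_V.
- exact: expect_UU.
- exact: expect_VV.
- exact: expect_UV.
- exists (rho ^+ 2); split; first by rewrite eigE.
  by move=> m; rewrite eigE => /eqP->.
- by move=> l []; rewrite eigE => /eqP -> _; rewrite sqrtr_sqr ger0_norm.
Qed.
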